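(* Suppose that the problem is severely ill-posed with regularity $\beta$, i.e. there are constants $C_1,C_2,\beta,c_0>0$ and $\alpha_0,\alpha_1\in\mathbb{R}$ such that $C_1(1+k^2)^{-\alpha_0/2}e^{-c_0k^\beta}\le|\rho_k|\le C_2(1+k^2)^{-\alpha_1/2}e^{-c_0k^\beta}$ as $k\to\infty$, that $f_0\in H^\gamma(\mathbb{H}_1)$ for some $\gamma>0$, and assign $f$ the mean-zero Gaussian prior distribution $\Pi=N(0,\Lambda)$ on $\mathbb{H}_1$, where the covariance operator $\Lambda$ has the same eigenvectors $\{e_k\}$ as $A^*A$, with eigenvalues $\tau_k^2=(1+k^2)^{-\delta-1/2}$ for some $\delta>\beta/2$. Then for a sufficiently large constant $C>0$, $$\Pi\left(f\in\mathbb{H}_1:\|f-f_0\|_1>C(\log n)^{-\frac{(\delta-\beta/2)\wedge\gamma}{\beta}}\ \Big|\ Y\right)\to0$$ in $\mathbb{P}_{f_0}$-probability as $n\to\infty$.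
   Context: $\mathbb{H}_1,\mathbb{H}_2$ are separable Hilbert spaces with inner products $\langle\cdot,\cdot\rangle_i$ and norms $\|\cdot\|_i$, $i=1,2$. $A:\mathbb{H}_1\to\mathbb{H}_2$ is a known, injective, continuous linear operator with adjoint $A^*$. It is assumed throughout that there is an orthonormal basis $\{e_k\}_{k\ge 1}$ of $\mathbb{H}_1$ consisting of eigenvectors of $A^*A$, with $A^*Ae_k=\rho_k^2 e_k$ ($A$ need not be compact in general), and $\{g_k\}$ is the conjugate orthonormal system in $\mathbb{H}_2$ (an orthonormal basis of the range of $A$) defined by $Ae_k=\rho_k g_k$. Write $f_k=\langle f,e_k\rangle_1$, and $a\wedge b=\min(a,b)$. Model: for each $n\ge1$ one observes $Y=Y^{(n)}=Af+n^{-1/2}Z$, where $Z$ is Gaussian white noise on $\mathbb{H}_2$, interpreted as the Gaussian process $Y=(Y_h:h\in\mathbb{H}_2)$, $Y_h=\langle Af,h\rangle_2+n^{-1/2}Z_h$, where $(Z_h)$ is a mean-zero Gaussian process with $\mathbb{E}Z_hZ_{h'}=\langle h,h'\rangle_2$. Its law is denoted $\mathbb{P}_f$. Equivalently, one observes the independent variables $Y_k:=Y_{g_k}\sim N(\rho_kf_k,n^{-1})$, $k\ge1$. The data $Y$ are generated from $\mathbb{P}_{f_0}$. Posterior: for a prior $\Pi$ on a $\sigma$-algebra $\mathcal{B}$, with support $\mathcal{P}$, the posterior is $\Pi(B\mid Y)=\int_B e^{n\sum_k\rho_kf_kY_k-\frac n2\|Af\|_2^2}d\Pi(f)\big/\int_{\mathcal{P}}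 e^{n\sum_k\rho_kf_kY_k-\frac n2\|Af\|_2^2}d\Pi(f)$, $B\in\mathcal{B}$. Sobolev scale: for $s\ge0$, $H^s(\mathbb{H}_1)=\{f\in\mathbb{H}_1:\|f\|_{H^s}^2:=\sum_{k\ge1}f_k^2(1+k^2)^s<\infty\}$. Gaussian measures: $N(0,\Lambda)$ is the law of a random element $G$ of $\mathbb{H}_1$ such that $(\langle G,h\rangle_1:h\in\mathbb{H}_1)$ is a mean-zero Gaussian process with covariance $\mathrm{cov}(\langle G,h\rangle_1,\langle G,h'\rangle_1)=\langle h,\Lambda h'\rangle_1$; here $\Lambda$ is positive semi-definite, self-adjoint and trace class. *)

(* Defs.v *)
From HB Require Import structures.
From mathcomp Require Import all_boot all_order all_algebra.
From mathcomp Require Import sesquilinear.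
From mathcomp Require Import all_classical all_reals all_analysis.

Set Implicit Arguments.
Unset Strict Implicit.
Unset Printing Implicit Defensive.

Import Order.TTheory GRing.Theory Num.Theory.
Import numFieldTopology.Exports numFieldNormedType.Exports.

Local Open Scope classical_set_scope.
Local Open Scope ring_scope.

Section hilbert.
Context {R : realType}.

(* Real scalars.  Completeness is part of completeNormedModType, and [dot] is
   a symmetric positive definite bilinear form. *)
Definition separable_hilbert (H : completeNormedModType R)
    (dot : {dot H for idfun}) : Prop :=
  (forall x : H, `|x| = Num.sqrt (dot x x)) /\
  (exists2 D : set H, countable D & dense D).

Definition is_adjoint (H1 H2 : completeNormedModType R)
    (dot1 : {dot H1 for idfun}) (dot2 : {dot H2 for idfun})
    (A : H1 -> H2) (Astar : H2 -> H1) : Prop :=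
  forall x y, dot2 (A x) y = dot1 x (Astar y).

Definition orthonormal_sequence (H : completeNormedModType R)
    (dot : {dot H for idfun}) (e : nat -> H) : Prop :=
  forall j k, dot (e j) (e k) = (j == k)%:R.

Definition orthonormal_basis (H : completeNormedModType R)
    (dot : {dot H for idfun}) (e : nat -> H) : Prop :=
  orthonormal_sequence dot e /\
  forall f : H, [series dot f (e k) *: e k]_k @ \oo --> f.

(* Mathematical sequences (x_k) with k >= 1 are encoded as nat -> _ with
   x_(k+1) at index k.  Hence this is 1 + k^2 for the k-th term. *)
Definition weight (k : nat) : R := 1 + k.+1%:R ^+ 2.

Definition sobolev (H : completeNormedModType R) (dot : {dot H for idfun})
    (e : nat -> H) (s : R) : set H :=
  [set f | (\sum_(0 <= k <oo) (dot f (e k) ^+ 2 * weight k `^ s)%:E < +oo)%E].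

Definition severely_ill_posed (rho : nat -> R) (beta : R) : Prop :=
  exists C1 C2 c0 alpha0 alpha1 : R,
    [/\ 0 < C1, 0 < C2, 0 < c0, 0 < beta &
      \forall k \near \oo,
        C1 * weight k `^ (- alpha0 / 2) * expR (- c0 * k.+1%:R `^ beta)
          <= `|rho k| /\
        `|rho k|
          <= C2 * weight k `^ (- alpha1 / 2) * expR (- c0 * k.+1%:R `^ beta)].

(* For a positive operator, being trace class amounts to summability of
   <u_k, Lambda u_k> along orthonormal sequences; when H is finite-dimensional
   there are none and the last clause is void. *)
Definition covariance_operator (H : completeNormedModType R)
    (dot : {dot H for idfun}) (Lambda : {linear H -> H}) : Prop :=
  [/\ continuous Lambda,
      forall x y, dot (Lambda x) y = dot x (Lambda y),
      forall x, 0 <= dot x (Lambda x) &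
      forall u : nat -> H, orthonormal_sequence dot u ->
        (\sum_(0 <= k <oo) (dot (u k) (Lambda (u k)))%:E < +oo)%E].

End hilbert.

Notation borel H := (g_sigma_algebraType (@open H)).

Section probability.
Context {R : realType}.

(* N(m, s^2).  The case s = 0 is treated apart because [normal_prob m 0] is
   not a point mass. *)
Definition gaussian_rv d (T : measurableType d) (P : probability T R)
    (X : T -> R) : Prop :=
  measurable_fun setT X /\
  exists m s : R, forall B : set R, measurable B ->
    P (X @^-1` B) = if s == 0 then \d_m B else normal_prob m s B.

Definition centered_gaussian_process d (T : measurableType d)
    (P : probability T R) (I : Type) (X : I -> T -> R) (K : I -> I -> R) :
    Prop :=
  [/\ forall (m : nat) (a : 'I_m -> R) (h : 'I_m -> I),
        gaussian_rv P (fun w => \sum_(j < m) a j * X (h j) w),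
      forall h, ('E_P[X h] = 0)%E &
      forall h h', covariance P (X h) (X h') = (K h h')%:E].

Definition white_noise (H : completeNormedModType R)
    (dot : {dot H for idfun}) d (T : measurableType d) (P : probability T R)
    (Z : H -> T -> R) : Prop :=
  centered_gaussian_process P Z (fun h h' => dot h h').

(* Pi = N(0, Lambda), as the law of the identity on (H, Pi). *)
Definition gaussian_measure (H : completeNormedModType R)
    (dot : {dot H for idfun}) (Lambda : {linear H -> H})
    (Pi : probability (borel H) R) : Prop :=
  covariance_operator dot Lambda /\
  centered_gaussian_process Pi (fun (h : H) (f : borel H) => dot f h)
    (fun h h' => dot h (Lambda h')).

Definition measure_support (H : completeNormedModType R)
    (Pi : probability (borel H) R) : set H :=
  [set f | forall U : set H, open U -> U f -> (0 < Pi U)%E].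

Definition observation (H1 H2 : completeNormedModType R)
    (dot2 : {dot H2 for idfun}) (A : H1 -> H2) (f : H1) (n : nat)
    (T : Type) (Z : H2 -> T -> R) (h : H2) (w : T) : R :=
  dot2 (A f) h + (Num.sqrt n%:R)^-1 * Z h w.

(* y k stands for the coordinate Y_(g_k) of the data.  The series is a limit
   of partial sums; it converges for almost all (f, Y). *)
Definition likelihood (H1 H2 : completeNormedModType R)
    (dot1 : {dot H1 for idfun}) (A : H1 -> H2) (e : nat -> H1)
    (rho : nat -> R) (n : nat) (y : nat -> R) (f : H1) : R :=
  expR (n%:R * limn [series rho k * dot1 f (e k) * y k]_k
        - n%:R / 2 * `|A f| ^+ 2).

Definition posterior (H1 H2 : completeNormedModType R)
    (dot1 : {dot H1 for idfun}) (A : H1 -> H2) (e : nat -> H1)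
    (rho : nat -> R) (Pi : probability (borel H1) R) (n : nat) (y : nat -> R)
    (B : set H1) : R :=
  (\int[Pi]_(f in B) likelihood dot1 A e rho n y f) /
  (\int[Pi]_(f in measure_support Pi) likelihood dot1 A e rho n y f).

Definition cvg0_in_probability (d : nat -> measure_display)
    (T : forall n, measurableType (d n)) (P : forall n, probability (T n) R)
    (X : forall n, T n -> R) : Prop :=
  forall eps : R, 0 < eps ->
    P n [set w | eps < `|X n w|] @[n --> \oo] --> 0%E.

End probability.

(* Main.v *)
Require Import Defs.
From HB Require Import structures.
From mathcomp Require Import all_boot all_order all_algebra.
From mathcomp Require Import sesquilinear.
From mathcomp Require Import all_classical all_reals all_analysis.
From mathcomp Require Import measurable_realfun.
From mathcomp Require Import ring lra.

Set Implicit Arguments.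
Unset Strict Implicit.
Unset Printing Implicit Defensive.

Import Order.TTheory GRing.Theory Num.Theory.
Import numFieldTopology.Exports numFieldNormedType.Exports.

Local Open Scope classical_set_scope.
Local Open Scope ring_scope.

(** Why the theorem holds.  Write v_k for the prior variances tau_k^2 and f_k
    for the coordinates of f in the eigenbasis.  Prior and likelihood are both
    products over the coordinates, so the posterior is a product of normal
    laws, with variance v_k / (1 + x_k) and mean b_k v_k / (1 + x_k), where
    x_k = n rho_k^2 v_k and b_k = n rho_k Y_k.  Its mean square distance to f0,
    averaged over the noise, is at most
      sum_k (3 v_k + 2 f0_k^2) / (1 + x_k),
    and by Markov's inequality it suffices that this sum, multiplied by
    (log n)^(2 kappa), tends to 0, kappa being the exponent of the rate
    ([posterior_tail_prob], [error_series_cvg0]).  For indices with k^beta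
    below a small multiple of log n, x_k exceeds a power of n; for the others
    (log n)^(2 kappa) is at most a constant times k^(2 kappa beta).  Since
    kappa beta is at most delta - beta/2 and at most gamma, the series of
    (v_k + f0_k^2) k^(2 kappa beta) converges, and dominated convergence
    concludes.  The bound tends to 0 after division by the squared radius, so
    every positive C is large enough.

    What remains is to make the product structure rigorous, starting from the
    laws of the linear functionals of the prior.  Independence is never
    established as such.  A factor exp(-c (x - p)^2 / 2) is a mean of cosines
    cos(t (x - p)) with t normal of variance c, and the characteristic
    function of <f, h> is known for every h, so products of such factors can
    be integrated one coordinate at a time ([integral_bump],
    [integral_prod_bump]).  The passage to infinitely many coordinates is by
    dominated convergence ([prior_domination]); it requires that
    sum_k |b_k| sqrt(v_k) be finite, which holds for almost all data because
    rho_k decays exponentially ([ae_summable_linear_term]).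

    The posterior second moment itself is not computed.  Instead,
      1_{|f - f0| > t} <= (1 - 1/e)^-1 (1 - exp(-|f - f0|^2 / t^2)),
    and multiplying the likelihood by exp(-eps |f - f0|^2 / 2) gives again the
    exponential of a diagonal quadratic form, so that the two integrals are
    compared factor by factor ([tilt_compare], [tilted_prior_dist],
    [posterior_ratio]). *)

(** * Integration against normal laws *)

Section normal_density.
Context {R : realType}.
Notation mu := (@lebesgue_measure R).

Lemma ae_eq_normal_density (m s : R) :
  ae_eq mu setT
    (Radon_Nikodym_SigmaFinite.f (normal_prob m s) mu)
    (fun x => (normal_pdf m s x)%:E).
Proof.
have dom := @normal_prob_dominates R m s.
apply: integral_ae_eq => //.
- exact: Radon_Nikodym_SigmaFinite.f_integrable.
- by apply/measurable_EFinP; exact: measurable_normal_pdf.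
- by move=> E _ mE; rewrite -Radon_Nikodym_SigmaFinite.f_integral.
Qed.

Lemma ge0_integral_normal_prob (m s : R) (f : R -> \bar R) :
  (forall x, 0 <= f x)%E -> measurable_fun setT f ->
  (\int[normal_prob m s]_x f x = \int[mu]_x (f x * (normal_pdf m s x)%:E))%E.
Proof.
move=> f0 mf; have dom := @normal_prob_dominates R m s.
rewrite -(Radon_Nikodym_SigmaFinite.change_of_variables dom)//.
apply: ae_eq_integral => //.
- apply: emeasurable_funM => //.
  exact: measurable_int (Radon_Nikodym_SigmaFinite.f_integrable dom).
- apply: emeasurable_funM => //.
  by apply/measurable_EFinP; exact: measurable_normal_pdf.
- by apply: ae_eqe_mul2l; exact: ae_eq_normal_density.
Qed.

Lemma integrable_normal_prob (m s : R) (f : R -> R) :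
  measurable_fun setT f ->
  (normal_prob m s).-integrable setT (EFin \o f) <->
  mu.-integrable setT (EFin \o (fun x => f x * normal_pdf m s x)).
Proof.
move=> mf.
have H : (\int[normal_prob m s]_x `|(f x)%:E| =
          \int[mu]_x `|(f x * normal_pdf m s x)%:E|)%E.
  rewrite ge0_integral_normal_prob//; last first.
    by apply: measurableT_comp => //; exact/measurable_EFinP.
  by apply: eq_integral => x _; rewrite EFinM abseM (gee0_abs (_ : 0 <=
    (normal_pdf m s x)%:E)%E)//
    lee_fin normal_pdf_ge0.
split => /integrableP[_ h]; apply/integrableP; split.
- apply/measurable_EFinP/measurable_funM => //.
  exact: measurable_normal_pdf.
- by rewrite -H.
- exact/measurable_EFinP.
- by rewrite H.
Qed.

Lemma integral_normal_prob (m s : R) (f : R -> R) :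
  (normal_prob m s).-integrable setT (EFin \o f) ->
  \int[normal_prob m s]_x f x = \int[mu]_x (f x * normal_pdf m s x).
Proof.
move=> If; have mf : measurable_fun setT f by apply/measurable_EFinP;
  exact: measurable_int If.
have Ip : (normal_prob m s).-integrable setT (EFin \o f^\+).
  exact: integrable_funrpos.
have In : (normal_prob m s).-integrable setT (EFin \o f^\-).
  exact: integrable_funrneg.
have mp : measurable_fun setT f^\+ by exact: measurable_funrpos.
have mn : measurable_fun setT f^\- by exact: measurable_funrneg.
have E (g : R -> R) : measurable_fun setT g -> (forall x, 0 <= g x) ->
    \int[normal_prob m s]_x g x = \int[mu]_x (g x * normal_pdf m s x).
  move=> mg g0; rewrite /Rintegral ge0_integral_normal_prob//.
  exact/measurable_EFinP.
rewrite -{1}(funrposBneg f) RintegralB//.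
rewrite !E//.
rewrite -RintegralB//; [|exact/integrable_normal_prob|exact/integrable_normal_prob].
apply: eq_Rintegral => x _; rewrite -mulrBl; congr (_ * _).
by have /(congr1 (fun h => h x)) := funrposBneg f.
Qed.

(** Completing the square.  A positive c yields integrable majorants, a
    negative c integrates a characteristic function against a normal law. *)
Lemma expR_normal_pdf (m s r c x : R) : s != 0 -> r != 0 ->
  c - (s ^+ 2 *+ 2)^-1 = - (r ^+ 2 *+ 2)^-1 ->
  expR (c * (x - m) ^+ 2) * normal_pdf m s x = `|r| / `|s| * normal_pdf m r x.
Proof.
move=> s0 r0 h; rewrite !normal_pdfE// /normal_peak /normal_fun.
have spi (a : R) : a != 0 -> Num.sqrt (a ^+ 2 * pi *+ 2) =
  `|a| * Num.sqrt (pi *+ 2).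
  by move=> a0; rewrite -mulrnAr sqrtrM ?sqr_ge0// sqrtr_sqr.
have n0 : Num.sqrt (pi *+ 2 : R) != 0.
  by rewrite gt_eqF// sqrtr_gt0 mulrn_wgt0// pi_gt0.
have -> : expR (- (x - m) ^+ 2 / (r ^+ 2 *+ 2)) =
    expR (c * (x - m) ^+ 2) * expR (- (x - m) ^+ 2 / (s ^+ 2 *+ 2)).
  by rewrite -expRD; congr expR; rewrite !mulNr -mulrN -h; ring.
by rewrite !spi//; field; rewrite n0 !normr_eq0 s0 r0.
Qed.

Lemma integral_expR_normal (m s r c : R) : s != 0 -> r != 0 ->
  c - (s ^+ 2 *+ 2)^-1 = - (r ^+ 2 *+ 2)^-1 ->
  (\int[normal_prob m s]_x (expR (c * (x - m) ^+ 2))%:E = (`|r| / `|s|)%:E)%E.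
Proof.
move=> s0 r0 h; rewrite ge0_integral_normal_prob//; last first.
  apply/measurable_EFinP; apply: measurableT_comp => //.
  by apply: measurable_funM => //; apply: measurable_funX;
    exact: measurable_funB.
under eq_integral do rewrite -EFinM (expR_normal_pdf _ _ s0 r0 h) EFinM.
rewrite integralZl//; last exact: integrable_normal_pdf.
by rewrite integral_normal_pdf mule1.
Qed.

(** The exponent is half of the one in the density, hence the density of
    standard deviation sqrt 2 * s on the other side. *)
Lemma integral_expR_normal_sqrt2 (m s : R) : s != 0 ->
  (\int[normal_prob m s]_x (expR ((s ^+ 2 *+ 4)^-1 * (x - m) ^+ 2))%:E =
  (Num.sqrt 2)%:E)%E.
Proof.
move=> s0; have s2 : Num.sqrt 2 * s != 0.
  by rewrite mulf_neq0// gt_eqF// sqrtr_gt0.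
rewrite (integral_expR_normal _ s0 s2).
  by rewrite normrM ger0_norm ?sqrtr_ge0// mulfK// normr_eq0.
rewrite exprMn sqr_sqrtr//; field.
by rewrite s0.
Qed.

(** This single majorant dominates all the polynomially bounded integrands
    below. *)
Lemma integrable_normal_le_expR (m s K : R) (f : R -> R) : s != 0 ->
  measurable_fun setT f ->
  (forall x, `|f x| <= K * expR ((s ^+ 2 *+ 4)^-1 * (x - m) ^+ 2)) ->
  (normal_prob m s).-integrable setT (EFin \o f).
Proof.
move=> s0 mf fK.
apply: (@le_integrable _ _ _ (normal_prob m s) setT measurableT _
  (fun x => K%:E * (expR ((s ^+ 2 *+ 4)^-1 * (x - m) ^+ 2))%:E)%E) => //.
- exact/measurable_EFinP.
- by move=> x _; rewrite -EFinM /= lee_fin (le_trans (fK x))// ler_norm.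
- apply: integrableZl => //; apply/integrableP; split.
    apply/measurable_EFinP; apply: measurableT_comp => //.
    by apply: measurable_funM => //; apply: measurable_funX;
      exact: measurable_funB.
  under eq_integral do rewrite gee0_abs ?lee_fin ?expR_ge0//.
  by rewrite integral_expR_normal_sqrt2// ltry.
Qed.

Lemma le_expR_sqr (m s x : R) : s != 0 ->
  1 + `|x - m| + (x - m) ^+ 2 <=
  (2 + 8 * s ^+ 2) * expR ((s ^+ 2 *+ 4)^-1 * (x - m) ^+ 2).
Proof.
move=> s0; set y := `|x - m|; rewrite -(real_normK (num_real (x - m))) -/y.
have s20 : 0 < s ^+ 2 by rewrite exprn_even_gt0.
have H := expR_ge1Dx ((s ^+ 2 *+ 4)^-1 * y ^+ 2).
apply: (@le_trans _ _ ((2 + 8 * s ^+ 2) * (1 + (s ^+ 2 *+ 4)^-1 * y ^+ 2))).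
  have -> : (2 + 8 * s ^+ 2) * (1 + (s ^+ 2 *+ 4)^-1 * y ^+ 2) =
    2 + 8 * s ^+ 2 + 2 * y ^+ 2 + (s ^+ 2)^-1 * y ^+ 2 / 2.
    by field; rewrite s0.
  have : 0 <= (s ^+ 2)^-1 * y ^+ 2 / 2.
    by rewrite divr_ge0// mulr_ge0 ?invr_ge0 ?sqr_ge0.
  by have := sqr_ge0 (y - 1/2); rewrite !expr2; nra.
by rewrite ler_wpM2l// addr_ge0// mulr_ge0// sqr_ge0.
Qed.

End normal_density.
(** * Stein's identity and the characteristic function of a normal law *)

Section char_normal.
Context {R : realType}.
Notation mu := (@lebesgue_measure R).

(** The fundamental theorem of calculus on growing symmetric intervals. *)
Lemma integral_derive_eq0 (F f : R -> R) :
  (forall x : R, is_derive x (1 : R) F (f x)) -> continuous f ->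
  mu.-integrable setT (EFin \o f) ->
  F n%:R @[n --> \oo] --> (0 : R) -> F (- n%:R) @[n --> \oo] --> (0 : R) ->
  (\int[mu]_x (f x)%:E)%E = 0%E.
Proof.
move=> dF cf If F0 F0'.
have mf : measurable_fun setT f by apply/measurable_EFinP;
  exact: measurable_int If.
pose I n := `[- (n.+1%:R : R), n.+1%:R]%classic.
have cF : continuous F.
  move=> x; apply: differentiable_continuous; apply/derivable1_diffP.
  by have := dF x.
have FTC n : (\int[mu]_x ((f \_ (I n)) x)%:E)%E =
  (F n.+1%:R - F (- n.+1%:R))%:E.
  have -> : (\int[mu]_x ((f \_ (I n)) x)%:E = \int[mu]_(x in I n) (f x)%:E)%E.
    by rewrite [RHS]integral_mkcond; apply: eq_integral => x _;
      rewrite restrict_EFin.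
  rewrite EFinB; apply: continuous_FTC2.
  - by rewrite gtrN.
  - exact: continuous_subspaceT.
  - split.
    + by move=> x _; have := dF x.
    + exact/cvg_at_right_filter/cF.
    + exact/cvg_at_left_filter/cF.
  - by move=> x _; rewrite derive1E; have [_ ->] := dF x.
have cvE : ([sequence (\int[mu]_x ((f \_ (I n)) x)%:E)%E]_n @ \oo --> 0%E).
  rewrite (_ : [sequence _]_n = (fun n => (F n.+1%:R - F (- n.+1%:R))%:E)).
    apply: cvg_EFin; first exact: nearW.
    rewrite -[X in _ --> X](subrr (0:R)).
    apply: (@cvgB _ R^o).
      by have := F0; rewrite -(cvg_shiftS (fun n : nat => F n%:R)).
    by have := F0'; rewrite -(cvg_shiftS (fun n : nat => F (- n%:R))).
  by apply/funext => n; rewrite /= FTC.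
have [|||||_ _ H] := @dominated_convergence _ _ _ mu setT measurableT
  (fun n x => ((f \_ (I n)) x)%:E) (EFin \o f) (fun x => `|f x|%:E).
- move=> n; apply/measurable_EFinP; apply/measurable_restrict => //.
    exact: measurable_itv.
  exact: measurable_funTS.
- exact/measurable_EFinP.
- apply: aeW => x _; apply: cvg_near_cst.
  near=> n; rewrite patchE ifT// inE /I/= in_itv/= -ler_norml.
  have : `|x| <= n%:R by near: n; exact: nbhs_infty_ger.
  by move=> /le_trans; apply; rewrite ler_nat.
- exact: integrable_norm.
- apply: aeW => x n _; rewrite patchE; case: ifPn => // _.
  by rewrite abse0 lee_fin.
apply/esym; apply: (cvg_unique _ cvE); first exact: ereal_hausdorff.
exact: H.
Unshelve. all: by end_near.
Qed.

End char_normal.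
Section stein.
Context {R : realType}.
Notation mu := (@lebesgue_measure R).
Variables (m s : R).
Hypothesis s0 : s != 0.
Notation N := (normal_prob m s).

Lemma cvg_sqr_dist_infty (z : nat -> R) (c : R) : 0 < c ->
  (forall n, n%:R <= `|z n|) -> expR (- (c * (z n -
    m) ^+ 2)) @[n --> \oo] --> (0 : R).
Proof.
move=> c0 zn.
have : c * (z n - m) ^+ 2 @[n --> \oo] --> +oo%R.
  apply/cvgryPge => A; near=> n.
  have H1 : 1 + `|m| <= n%:R by near: n; exact: nbhs_infty_ger.
  have H3 : A / c + `|m| <= n%:R by near: n; exact: nbhs_infty_ger.
  have H2 : n%:R - `|m| <= `|z n - m|.
    by rewrite (le_trans _ (lerB_dist _ _))// lerB.
  rewrite mulrC -ler_pdivrMr// -(real_normK (num_real (z n - m))).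
  apply: (@le_trans _ _ `|z n - m|); first lra.
  by rewrite expr2 ler_peMl//; lra.
move=> h.
exact: (cvg_comp _ _ h (@cvgr_expR R)).
Unshelve. all: by end_near.
Qed.

Lemma is_derive_normal_pdf (x : R) :
  is_derive x (1 : R) (normal_pdf m s) (- (x - m) / s ^+ 2 * normal_pdf m s x).
Proof.
rewrite normal_pdfE//; rewrite /normal_fun.
apply: is_derive_eq.
rewrite /GRing.scale/= !(mulr0,mul0r,addr0,add0r,subr0,mulr1,mul1r).
by field; rewrite s0.
Qed.

(** Integration by parts: the derivative of h times the density is
    h' - (x - m) h / s^2 times the density, and h times the density vanishes
    at infinity. *)
Lemma normal_stein (h h' : R -> R) (K : R) :
  (forall x : R, is_derive x (1 : R) h (h' x)) -> continuous h' ->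
  (forall x, `|h x| <= K * (1 + `|x - m|)) -> (forall x, `|h' x| <= K) ->
  \int[N]_x ((x - m) * h x) = s ^+ 2 * \int[N]_x h' x.
Proof.
move=> dh ch' hK h'K.
have K0 : 0 <= K by exact: le_trans (h'K 0).
have s20 : 0 < s ^+ 2 by rewrite exprn_even_gt0.
have ch : continuous h.
  move=> x; apply: differentiable_continuous; apply/derivable1_diffP.
  by have := dh x.
have mh : measurable_fun setT h by exact: continuous_measurable_fun.
have mh' : measurable_fun setT h' by exact: continuous_measurable_fun.
have mxh : measurable_fun setT (fun x : R => (x - m) * h x).
  by apply: measurable_funM => //; exact: measurable_funB.
have Ih' : N.-integrable setT (EFin \o h').
  apply: (@integrable_normal_le_expR _ _ _ (K * (2 + 8 * s ^+ 2))) => // x.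
  rewrite (le_trans (h'K x))// -mulrA ler_peMr//.
  apply: le_trans (le_expR_sqr m x s0).
  by have := normr_ge0 (x - m); have := sqr_ge0 (x - m); lra.
have Ixh : N.-integrable setT (EFin \o (fun x : R => (x - m) * h x)).
  apply: (@integrable_normal_le_expR _ _ _ (K * (2 + 8 * s ^+ 2))) => // x.
  rewrite normrM mulrC (le_trans (ler_wpM2r _ (hK x)))// -!mulrA ler_wpM2l//.
  apply: le_trans (le_expR_sqr m x s0).
  by rewrite -(real_normK (num_real (x - m))); nra.
pose f x := (h' x - (s ^+ 2)^-1 * ((x - m) * h x)) * normal_pdf m s x.
have I2 : N.-integrable setT (EFin \o (fun x : R => (s ^+ 2)^-1 * ((x - m) *
  h x))).
  rewrite (_ : _ \o _ = (fun x : R => (s ^+ 2)^-1%:E *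
    (EFin \o (fun x : R => ((x - m) * h x)%R)) x))%E; last by apply/funext.
  by apply: integrableZl.
have If : N.-integrable setT (EFin \o (fun x : R => h' x - (s ^+ 2)^-1 * ((x -
  m) * h x))).
  rewrite (_ : _ \o _ = (EFin \o h') \- (EFin \o (fun x : R => ((s ^+ 2)^-1 *
    ((x - m) * h x))%R)))%E; last by apply/funext.
  exact: integrableB.
have decay (z : nat -> R) : (forall n, n%:R <= `|z n|) ->
    (h \* normal_pdf m s) (z n) @[n --> \oo] --> (0 : R).
  move=> zn.
  (* the majorant times the density is a density of deviation sqrt 2 * s *)
  pose r := Num.sqrt 2 * s.
  have r0 : r != 0 by rewrite mulf_neq0// gt_eqF// sqrtr_gt0.
  have rs : (s ^+ 2 *+ 4)^-1 - (s ^+ 2 *+ 2)^-1 = - (r ^+ 2 *+ 2)^-1.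
    by rewrite exprMn sqr_sqrtr//; field; rewrite s0.
  pose C := K * (2 + 8 * s ^+ 2) * (`|r| / `|s| * normal_peak r).
  have c0 : 0 < (r ^+ 2 *+ 2)^-1.
    by rewrite invr_gt0 pmulrn_lgt0// exprn_even_gt0.
  have cv : C * expR (- ((r ^+ 2 *+ 2)^-1 * (z n -
    m) ^+ 2)) @[n --> \oo] --> (0 : R).
    rewrite -[X in _ --> X](mulr0 C).
    by apply: cvgMr; exact: cvg_sqr_dist_infty.
  apply: norm_cvg0; apply: (squeeze_cvgr _ (cvg_cst 0) cv).
  apply: nearW => n; rewrite normr_ge0/= normrM (ger0_norm (normal_pdf_ge0 _ _
    _)).
  apply: (@le_trans _ _ (K * ((2 + 8 * s ^+ 2) *
      expR ((s ^+ 2 *+ 4)^-1 * (z n - m) ^+ 2)) * normal_pdf m s (z n))).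
    rewrite ler_wpM2r ?normal_pdf_ge0// (le_trans (hK _))// ler_wpM2l//.
    apply: le_trans (le_expR_sqr m (z n) s0).
    by rewrite lerDl sqr_ge0.
  rewrite -!mulrA (expR_normal_pdf _ _ s0 r0 rs) normal_pdfE// /normal_fun.
  by rewrite /C -!mulrA mulNr [_^-1 * _ ^+ 2]mulrC.
have : (\int[mu]_x (f x)%:E)%E = 0%E.
  apply: (@integral_derive_eq0 _ (h \* normal_pdf m s)).
  - move=> x; have dp := is_derive_normal_pdf x; have dhx := dh x.
    apply: is_derive_eq.
    by rewrite /f /GRing.scale/=; field.
  - move=> x; apply: cvgM; last exact: continuous_normal_pdf.
    apply: cvgB; first exact: ch'.
    apply: cvgM; first exact: cvg_cst.
    apply: cvgM; last exact: ch.
    by apply: cvgB; [exact: cvg_id|exact: cvg_cst].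
  - apply/integrable_normal_prob => //.
    by apply/measurable_EFinP; exact: measurable_int If.
  - by apply: decay => n; rewrite normr_nat.
  - by apply: decay => n; rewrite normrN normr_nat.
move=> /(congr1 fine); rewrite -/(Rintegral _ _ _) -integral_normal_prob//.
rewrite RintegralB//.
rewrite RintegralZl// => /eqP; rewrite subr_eq0 => /eqP ->.
by rewrite mulrA divff ?mul1r// gt_eqF.
Qed.

End stein.
Section transfer.
Context {R : realType} d (T : measurableType d) (P : probability T R) (X : T ->
  R)
  (mu : probability (measurableTypeR R) R).
Hypothesis mX : measurable_fun setT X.
Hypothesis lawX : forall B : set R, measurable B -> P (X @^-1` B) = mu B.

(* normal_prob is a measure on this copy of the Borel sets of R *)
Let X' : T -> measurableTypeR R := X.
Let mX' : measurable_fun setT X' := mX.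
Let mX_mixin := isMeasurableFun.Build _ _ _ _ _ mX'.
Let mX_pack : {mfun T >-> measurableTypeR R} := HB.pack X' mX_mixin.

Let law (g : measurableTypeR R -> \bar R) :
  (\int[mu]_x g x = \int[pushforward P mX_pack]_x g x)%E.
Proof.

 by apply: (eq_measure_integral (pushforward P mX_pack)) => B mB _;
   exact/esym/lawX. Qed.

Lemma integral_law (f : R -> R) : mu.-integrable setT (EFin \o f) ->
  P.-integrable setT (EFin \o (f \o X)) /\
  \int[P]_w f (X w) = \int[mu]_x f x.
Proof.
move=> If.
have mf : measurable_fun setT (EFin \o f) by exact: measurable_int If.
have I1 : P.-integrable setT (EFin \o (f \o X)).
  apply/integrableP; split; first exact: measurableT_comp mf mX.
  have := integrable_lty measurableT (integrable_abse If).
  rewrite law ge0_integral_pushforward//.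
    exact: measurableT_comp.
  by move=> x _; exact: abse_ge0.
split=> //; rewrite /Rintegral law integral_pushforward//.
Qed.

Lemma ge0_integral_law (f : R -> \bar R) : measurable_fun setT f ->
  (forall x, 0 <= f x)%E -> (\int[P]_w f (X w) = \int[mu]_x f x)%E.
Proof.
move=> mf f0.
by rewrite law ge0_integral_pushforward.
Qed.

End transfer.

Section moments.
Context {R : realType}.
Implicit Types m s : R.

Lemma Rintegral_cst1 d (T : measurableType d) (P : probability T R) (r : R) :
  \int[P]__ r = r.
Proof. rewrite Rintegral_cst//=. have -> : P setT =
  1%E by exact: probability_setT. by rewrite mulr1. Qed.

Lemma integrable_normal_id m s : s != 0 ->
  (normal_prob m s).-integrable setT (EFin \o (@id R)).
Proof.
move=> s0; apply: (@integrable_normal_le_expR _ _ _ ((1 + `|m|) * (2 + 8 *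
  s ^+ 2))) => // x.
rewrite -mulrA; apply: (@le_trans _ _ ((1 + `|m|) * (1 + `|x - m|  + (x -
  m) ^+ 2))).
  have : `|x| <= `|x - m| + `|m| by rewrite (le_trans _ (ler_normD _ _))//
    subrK.
  have := normr_ge0 m; have := normr_ge0 (x - m); have := sqr_ge0 (x - m).
  by rewrite /id; nra.
by rewrite ler_wpM2l ?addr_ge0// le_expR_sqr.
Qed.

Lemma normal_mean m s : s != 0 -> \int[normal_prob m s]_x x = m.
Proof.
move=> s0.
have := @normal_stein R m s s0 (cst 1) (cst 0) 1.
rewrite /cst => /(_ _ _ _ _).
have H : \int[normal_prob m s]_x (x - m) = \int[normal_prob m s]_x x - m.
  rewrite RintegralB//; last 2 first.
  - exact: integrable_normal_id.
  - exact: finite_measure_integrable_cst.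
  by rewrite (Rintegral_cst1 (normal_prob m s)).
move=> K; apply/eqP; rewrite -subr_eq0 -H; apply/eqP.
under eq_Rintegral do rewrite -[_ - m]mulr1.
rewrite K ?(Rintegral_cst1 (normal_prob m s)) ?mulr0//.
- by move=> x; exact: cst_continuous.
- by move=> x; rewrite normr1 mul1r lerDl.
- by move=> x; rewrite normr0.
Qed.

Lemma normal_second_moment s : s != 0 ->
  (\int[normal_prob 0 s]_x (x ^+ 2)%:E = (s ^+ 2)%:E)%E.
Proof.
move=> s0.
have := @normal_stein R 0 s s0 (@id R) (cst 1) 1.
move=> /(_ _ _ _ _).
rewrite (Rintegral_cst1 (normal_prob 0 s)) mulr1 => K.
have I2 : (normal_prob 0 s).-integrable setT (EFin \o (fun x : R => x ^+ 2)).
  apply: (@integrable_normal_le_expR _ _ _ (2 + 8 * s ^+ 2)) => // x.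
  rewrite ger0_norm ?sqr_ge0//; apply: le_trans (le_expR_sqr 0 x s0).
  by rewrite subr0; have := normr_ge0 x; lra.
have -> : (\int[normal_prob 0 s]_x (x ^+ 2)%:E =
    (\int[normal_prob 0 s]_x (x ^+ 2))%:E)%E.
  by rewrite fineK//; apply: integrable_fin_num.
congr EFin; rewrite -K.
- by apply: eq_Rintegral => x _; rewrite subr0.
- by move=> x; exact: cst_continuous.
- by move=> x; rewrite subr0 mul1r lerDr.
- by move=> x; rewrite normr1.
Qed.

Lemma integrable_bounded d (T : measurableType d) (P : probability T R) (f : T
  -> R) K :
  measurable_fun setT f -> (forall x, `|f x| <= K) ->
    P.-integrable setT (EFin \o f).
Proof.
move=> mf fK; apply: measurable_bounded_integrable => //.
  by apply: (@le_lt_trans _ _ 1%E); [exact: probability_le1|rewrite ltry].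
exists K; split; first exact: num_real.
by move=> y Ky x _; apply: le_trans (fK x) _; exact: ltW.
Qed.

Lemma measurable_cos_affine (t th : R) : measurable_fun setT (fun x : R => cos
  (t * x + th)).
Proof.
apply: measurableT_comp; first exact: continuous_measurable_fun
  (@continuous_cos R).
by apply: measurable_funD => //; exact: measurable_funM.
Qed.

(** Differentiating in t and applying Stein's identity, the integral F solves
    F'(t) = - s^2 t F(t).  The phase th carries the cosine and the sine
    transforms along together. *)
Lemma normal_char s (t th : R) : s != 0 ->
  \int[normal_prob 0 s]_x cos (t * x + th) = cos th * expR (- (t ^+ 2 *
    s ^+ 2 / 2)).
Proof.
move=> s0; pose N := normal_prob 0 s.
pose F t := \int[N]_x cos (t * x + th).
have dF (u : R) : is_derive u (1 : R) F (- (u * s ^+ 2 * F u)).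
  have Iuv : `]u - 1, u + 1[%classic u by rewrite /= in_itv/=; lra.
  have pd (x : R) (y : R) : is_derive x (1 : R) (fun x => cos (x * y +
    th)) (- sin (x * y + th) * y).
    apply: is_derive_eq; rewrite /GRing.scale/=.
    by rewrite !(mulr0,mul0r,addr0,add0r,subr0,mulr1,mul1r) mulrC.
  have If (x : R) : N.-integrable setT (EFin \o (fun y => cos (x * y + th))).
    apply: (@integrable_bounded _ _ _ _ 1); first exact: measurable_cos_affine.
    by move=> y; rewrite ler_norml cos_geN1 cos_le1.
  have Iabs : N.-integrable setT (EFin \o (fun y : R => `|y|)).
    exact: integrable_norm (integrable_normal_id 0 s0).
  have dom (x y : R) : `]u - 1, u + 1[%classic x -> [set: R] y ->
     `|partial1of2 (fun x y => cos (x * y + th)) x y| <= `|y|.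
    move=> _ _; rewrite partial1of2E; have [_ ->] := pd x y.
    rewrite normrM normrN ler_piMl// ler_norml sin_geN1 sin_le1//.
  have der (x y : R) : `]u - 1, u + 1[%classic x -> [set: R] y ->
    derivable (fun x : R => cos (x * y + th)) x 1.
    by move=> _ _; have := pd x y.
  have := @differentiation_under_integral R _ _ N _ setT measurableT u _ _ Iuv
    (fun x _ => If x) der _ (fun y => normr_ge0 y) Iabs dom.
  have dF := @derivable_under_integral R _ _ N _ setT measurableT u _ _ Iuv
    (fun x _ => If x) der _ (fun y => normr_ge0 y) Iabs dom.
  rewrite derive1E => FE.
  split => //; rewrite [LHS]FE.
  under eq_Rintegral => y _.
    rewrite partial1of2E; have [_ ->] := pd u y.
    rewrite mulrC; over.
  have ST : \int[N]_x (x * - sin (u * x + th)) =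
      s ^+ 2 * \int[N]_x (- (u * cos (u * x + th))).
    have d1 (x : R) : is_derive x (1 : R) (fun x : R => - sin (u * x + th))
        (- (u * cos (u * x + th))).
      apply: is_derive_eq; rewrite /GRing.scale/=.
      by rewrite !(mulr0,mul0r,addr0,add0r,subr0,mulr1,mul1r); ring.
    rewrite -(@normal_stein R 0 s s0 _ _ (1 + `|u|) d1).
    - by apply: eq_Rintegral => x _; rewrite subr0.
    - move=> x; apply: cvgN; apply: cvgM; first exact: cvg_cst.
      apply: (@continuous_comp _ _ _ (fun x : R => u * x + th) cos);
        last exact: continuous_cos.
      by apply: cvgD; [apply: cvgM; [exact: cvg_cst|exact: cvg_id]|exact:
        cvg_cst].
    - move=> x; rewrite normrN.
      have : `|sin (u * x + th)| <= 1 by rewrite ler_norml sin_geN1 sin_le1.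
      by have := normr_ge0 u; have := normr_ge0 (x - 0); nra.
    - move=> x; rewrite normrN normrM.
      have : `|cos (u * x + th)| <= 1 by rewrite ler_norml cos_geN1 cos_le1.
      by have := normr_ge0 u; nra.
  rewrite ST.
  under [in LHS]eq_Rintegral do rewrite -mulNr.
  rewrite RintegralZl//.
  by rewrite /F; ring.
pose G t := F t * expR (t ^+ 2 * s ^+ 2 / 2).
have dG (u : R) : is_derive u (1 : R) G 0.
  have dFu := dF u.
  apply: is_derive_eq; rewrite /GRing.scale/=.
  by rewrite !(mulr0,mul0r,addr0,add0r,subr0,mulr1,mul1r); field.
have := is_derive_0_is_cst t 0 dG.
rewrite /G expr0n/= !mul0r expR0 mulr1.
have -> : F 0 = cos th.
  rewrite /F; under eq_Rintegral do rewrite mul0r add0r.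
  by rewrite (Rintegral_cst1 N).
by move=> <-; rewrite -(mulrA (F t)) -expRD subrr expR0 mulr1.
Qed.

End moments.
(** * Centered Gaussian variables *)

Section centered_gaussian.
Context {R : realType} d (T : measurableType d) (P : probability T R).

Lemma covariance_centered (X : T -> R) : 'E_P[X]%E = 0%E ->
  covariance P X X = (\int[P]_w (X w ^+ 2)%:E)%E.
Proof.
move=> EX; rewrite covariance.unlock EX /= expectation.unlock.
by apply: eq_integral => w _; rewrite /= mulrfctE/= subr0 expr2.
Qed.

(** The parameters (m, s) of the law are recovered from the first two
    moments; s = 0 is the point mass, for which the variance is zero.  The
    last clause provides the exponential moments used for domination. *)
Lemma gaussian_rv_centered (X : T -> R) (V : R) :
  gaussian_rv P X -> 'E_P[X]%E = 0%E -> covariance P X X = V%:E ->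
  [/\ measurable_fun setT X,
      forall th, \int[P]_w cos (X w + th) = cos th * expR (- (V / 2)) &
      0 < V -> (\int[P]_w (expR ((V *+ 4)^-1 * X w ^+ 2))%:E =
        (Num.sqrt 2)%:E)%E].
Proof.
move=> [mX [m [s law]]] EX; rewrite covariance_centered// => VX.
have [s0|s0] := eqVneq s 0.
- move: law; rewrite s0 eqxx => law.
  pose D : probability (measurableTypeR R) R :=
    @dirac _ (measurableTypeR R) m R.
  have lawX (B : set R) : measurable B -> P (X @^-1` B) = D B.
    by move=> mB; rewrite law.
  have Id (f : R -> R) : measurable_fun setT f ->
      (D.-integrable setT (EFin \o f) /\ \int[D]_x f x = f m).
    move=> mf.
    have mf' : measurable_fun (setT : set (measurableTypeR R)) (EFin \o f).
      exact/measurable_EFinP.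
    split; last by rewrite /Rintegral integral_dirac// [X in (X *
      _)%E]diracT mul1e.
    apply/integrableP; split => //.
    by rewrite integral_dirac// ?[X in (X * _)%E]diracT ?mul1e ?ltry//;
      exact: measurableT_comp.
  have [I1 E1] := Id id (@measurable_id _ _ _).
  have m0 : m = 0.
    rewrite -[LHS]E1; have [_ <-] := integral_law mX lawX I1.
    by rewrite /Rintegral; move: EX; rewrite expectation.unlock => ->.
  have V0 : V = 0.
    apply: EFin_inj; rewrite -VX.
    have mf : measurable_fun (setT : set (measurableTypeR R)) (fun x => (x ^+
      2)%:E).
      by apply/measurable_EFinP; exact: measurable_funX.
    rewrite (ge0_integral_law mX lawX (f := fun x => (x ^+ 2)%:E))//.
      by rewrite integral_dirac// [X in (X * _)%E]diracT mul1e m0 expr0n.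
    by move=> x; rewrite lee_fin sqr_ge0.
  split=> // [th|]; last by rewrite V0 ltxx.
  have [I2 E2] := Id (fun x : R => cos (1 * x +
    th)) (measurable_cos_affine _ _).
  have [_] := integral_law mX lawX I2; rewrite E2.
  under eq_Rintegral do rewrite mul1r.
  by move=> ->; rewrite m0 V0 mulr0 add0r mul0r oppr0 expR0 mulr1.
- have lawX (B : set R) : measurable B -> P (X @^-1` B) = normal_prob m s B.
    by move=> mB; rewrite law// (negbTE s0).
  have m0 : m = 0.
    rewrite -[LHS](normal_mean m s0).
    have [_ <-] := integral_law mX lawX (integrable_normal_id m s0).
    by rewrite /Rintegral; move: EX; rewrite expectation.unlock => ->.
  have Vs : V = s ^+ 2.
    apply: EFin_inj; rewrite -VX -normal_second_moment//.
    rewrite (ge0_integral_law mX lawX (f := fun x => (x ^+ 2)%:E)) ?m0//.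
      by apply/measurable_EFinP; exact: measurable_funX.
    by move=> x; rewrite lee_fin sqr_ge0.
  split => // [th|_].
    have Ic : (normal_prob m s).-integrable setT (EFin \o (fun x => cos (1 *
      x + th))).
      apply: (@integrable_bounded _ _ _ _ _ 1);
        first exact: measurable_cos_affine.
      by move=> y; rewrite ler_norml cos_geN1 cos_le1.
    have [_] := integral_law mX lawX Ic.
    under eq_Rintegral do rewrite mul1r.
    by move=> ->; rewrite m0 normal_char// expr1n mul1r Vs.
  rewrite (ge0_integral_law mX lawX (f := fun x => (expR ((V *+ 4)^-1 *
    x ^+ 2))%:E)).
  - rewrite m0 Vs -(integral_expR_normal_sqrt2 0 s0).
    by apply: eq_integral => x _; rewrite subr0.
  - apply/measurable_EFinP; apply: measurableT_comp => //.
    by apply: measurable_funM => //; exact: measurable_funX.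
  - by move=> x; rewrite lee_fin expR_ge0.
Qed.

End centered_gaussian.
(** * Gaussian factors as mixtures of cosines *)

Section mixture.
Context {R : realType}.

Lemma Rintegral_Fubini_bounded d1 d2 (T1 : measurableType d1) (T2 :
  measurableType d2)
    (P1 : probability T1 R) (P2 : probability T2 R) (f : T1 * T2 -> R) (K : R) :
  measurable_fun setT f -> (forall z, `|f z| <= K) ->
  \int[P1]_x \int[P2]_y f (x, y) = \int[P2]_y \int[P1]_x f (x, y).
Proof.
move=> mf fK.
have I1 x : P2.-integrable setT (fun y => (f (x, y))%:E).
  apply: (@integrable_bounded _ _ _ _ _ K); last by move=> y; exact: fK.
  exact: measurableT_comp mf (pair1_measurable x).
have I2 y : P1.-integrable setT (fun x => (f (x, y))%:E).
  apply: (@integrable_bounded _ _ _ _ _ K); last by move=> x; exact: fK.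
  exact: measurableT_comp mf (pair2_measurable y).
have mf' : measurable_fun setT (EFin \o f) by exact/measurable_EFinP.
have If : (P1 \x P2)%E.-integrable setT (EFin \o f).
  apply/integrable12ltyP => //.
  apply: (@le_lt_trans _ _ (\int[P1]_x \int[P2]_y K%:E)%E).
    apply: ge0_le_integral => //.
    - by move=> x _; apply: integral_ge0.
    - apply: (measurable_fun_fubini_tonelli_F (abse \o (EFin \o f))) => //=.
      exact: measurableT_comp.
    - move=> x _; apply: ge0_le_integral => //.
      + apply: measurableT_comp => //.
        exact: measurableT_comp mf' (pair1_measurable x).
      + by move=> y _; rewrite lee_fin; exact: fK.
  under eq_integral do rewrite integral_cst//.
  rewrite /= integral_cst//.
  rewrite [X in (_ * X < _)%E](probability_setT P1).
  by rewrite mule1 [X in (_ * X < _)%E](probability_setT P2) mule1 ltry.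
rewrite /Rintegral.
transitivity (fine (\int[P1]_x \int[P2]_y (f (x, y))%:E)%E).
  by congr fine; apply: eq_integral => x _; rewrite fineK// integrable_fin_num.
rewrite (Fubini If); congr fine; apply: eq_integral => y _.
by rewrite fineK// integrable_fin_num.
Qed.

(** The mean of exp(-c (X - p)^2 / 2) when X is N(0, v). *)
Definition bump_mean (c p v : R) : R :=
  (Num.sqrt (1 + c * v))^-1 * expR (- (p ^+ 2 * c / (1 + c * v) / 2)).

Lemma expR_bump (c p x : R) : 0 < c ->
  expR (- (c * (x - p) ^+ 2 / 2)) =
  \int[normal_prob 0 (Num.sqrt c)]_t cos (t * (x - p)).
Proof.
move=> c0.
have := @normal_char R (Num.sqrt c) (x - p) 0.
rewrite cos0 mul1r sqr_sqrtr ?ltW// (mulrC _ c) => <-.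
  by apply: eq_Rintegral => t _; rewrite addr0 mulrC.
by rewrite gt_eqF// sqrtr_gt0.
Qed.

Lemma measurable_expR_sqr (v : R) :
  measurable_fun setT (fun t : R => expR (- (t ^+ 2 * v / 2))).
Proof.
apply: measurableT_comp => //; apply: measurableT_comp => //.
by apply: measurable_funM => //; apply: measurable_funM => //;
  exact: measurable_funX.
Qed.

Lemma integral_cos_expR (c p v : R) : 0 < c -> 0 <= v ->
  \int[normal_prob 0 (Num.sqrt c)]_t (cos (t * p) * expR (- (t ^+ 2 * v / 2))) =
  bump_mean c p v.
Proof.
move=> c0 v0.
have cv : 0 < 1 + c * v by rewrite ltr_wpDr// mulr_ge0// ltW.
pose s := Num.sqrt c; pose r := Num.sqrt (c / (1 + c * v)).
have s0 : s != 0 by rewrite gt_eqF// sqrtr_gt0.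
have r0 : r != 0 by rewrite gt_eqF// sqrtr_gt0 divr_gt0.
have mc : measurable_fun setT (fun t : R => cos (t * p)).
  under eq_fun do rewrite -[X in cos X]addr0 mulrC.
  exact: measurable_cos_affine.
have Ic (u : R) : (normal_prob 0 u).-integrable setT (EFin \o (fun t : R => cos
  (t * p))).
  apply: (@integrable_bounded _ _ _ _ _ 1) => // t.
  by rewrite ler_norml cos_geN1 cos_le1.
rewrite integral_normal_prob; last first.
  apply: (@integrable_bounded _ _ _ _ _ 1).
    apply: measurable_funM; first exact: mc.
    exact: measurable_expR_sqr.
  move=> t; rewrite normrM mulr_ile1//.
    by rewrite ler_norml cos_geN1 cos_le1.
  rewrite ger0_norm ?expR_ge0// -expR0 ler_expR oppr_le0 divr_ge0// mulr_ge0//.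
  exact: sqr_ge0.
have h : - (v / 2) - (s ^+ 2 *+ 2)^-1 = - (r ^+ 2 *+ 2)^-1.
  rewrite !sqr_sqrtr ?ltW// ?divr_gt0//; field.
  by rewrite !gt_eqF.
transitivity (\int[lebesgue_measure]_t (`|r| / `|s| * (cos (t * p) *
  normal_pdf 0 r t))).
  apply: eq_Rintegral => t _; rewrite mulrCA -(expR_normal_pdf 0 t s0 r0 h)
    subr0.
  by rewrite -mulrA; congr (_ * (expR _ * _)); ring.
rewrite RintegralZl//; last first.
  by have /integrable_normal_prob := Ic r; exact.
rewrite -integral_normal_prob//.
have := @normal_char R r p 0 r0.
rewrite cos0 mul1r => E.
under eq_Rintegral do rewrite -[X in cos X]addr0 mulrC.
rewrite E /bump_mean; congr (_ * expR _).
  rewrite !ger0_norm ?sqrtr_ge0//.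
  have -> : r = s / Num.sqrt (1 + c * v) by rewrite /r sqrtrM ?ltW// sqrtrV
    ?ltW.
  by field; rewrite s0 gt_eqF// sqrtr_gt0.
by rewrite sqr_sqrtr ?mulrA// ltW// divr_gt0.
Qed.

(** The hypothesis says, through characteristic functions, that X is N(0, v)
    and independent of (Y, Z) as far as Y cos(Z + th) is concerned.  Writing
    the Gaussian factor as a mean of cos(t (X - p)) and exchanging the
    integrals, the product of cosines becomes a half sum of two cosines to
    which the hypothesis applies. *)
Lemma integral_bump d (T : measurableType d) (P : probability T R)
    (Y X Z : T -> R) (K c p v k : R) :
  0 < c -> 0 <= v -> measurable_fun setT Y -> measurable_fun setT X ->
  measurable_fun setT Z -> (forall w, `|Y w| <= K) ->
  (forall t th, \int[P]_w (Y w * cos (t * X w + Z w + th)) =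
     k * cos th * expR (- (t ^+ 2 * v / 2))) ->
  forall th, \int[P]_w (Y w * expR (- (c * (X w - p) ^+ 2 / 2)) * cos (Z w +
    th)) =
    k * bump_mean c p v * cos th.
Proof.
move=> c0 v0 mY mX mZ YK H th.
pose N := normal_prob 0 (Num.sqrt c).
pose f (z : T * R) := Y z.1 * cos (z.2 * (X z.1 - p)) * cos (Z z.1 + th).
have cosl (x : R) : `|cos x| <= 1 by rewrite ler_norml cos_geN1 cos_le1.
have mcos : measurable_fun setT (@cos R) by exact: continuous_measurable_fun
  (@continuous_cos R).
have mYcos t u : measurable_fun setT (fun w => Y w * cos (t * X w + Z w + u)).
  apply: measurable_funM => //; apply: measurableT_comp => //.
  by apply: measurable_funD => //; apply: measurable_funD => //;
    exact: measurable_funM.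
have IYcos t u : P.-integrable setT (EFin \o (fun w => Y w * cos (t * X w +
  Z w + u))).
  apply: (@integrable_bounded _ _ _ _ _ K) => // w.
  by rewrite normrM (le_trans _ (YK w))// ler_piMr.
have mf : measurable_fun setT f.
  have m1 (g : T -> R) : measurable_fun setT g ->
    measurable_fun setT (fun z : T * R => g z.1).
    by move=> mg; exact: measurableT_comp.
  apply: measurable_funM; last first.
    by apply: measurableT_comp => //; apply: measurable_funD => //; exact: m1.
  apply: measurable_funM; first exact: m1.
  apply: measurableT_comp => //; apply: measurable_funM;
    first exact: measurable_snd.
  by apply: measurable_funB => //; exact: m1.
have fK z : `|f z| <= K.
  rewrite /f normrM (le_trans _ (YK z.1))//.
  by rewrite -[leRHS]mulr1 ler_pM// normrM ler_piMr.
have mct (u : R) : measurable_fun setT (fun t : R => cos (t * u)).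
  by apply: measurableT_comp => //; exact: measurable_funM.
have Ict (u : R) : N.-integrable setT (EFin \o (fun t : R => cos (t * u))).
  apply: (@integrable_bounded _ _ _ _ _ 1); first exact: mct.
  by move=> t; exact: cosl.
transitivity (\int[P]_w \int[N]_t f (w, t)).
  apply: eq_Rintegral => w _; rewrite expR_bump//.
  rewrite mulrAC -RintegralZl//.
  by apply: eq_Rintegral => t _; rewrite /f/= mulrAC.
rewrite (@Rintegral_Fubini_bounded _ _ _ _ P (normal_prob 0 (Num.sqrt c)) f K
  mf fK).
rewrite mulrAC -integral_cos_expR// -RintegralZl//; last first.
  apply: (@integrable_bounded _ _ _ _ _ 1).
    apply: measurable_funM; first exact: mct.
    exact: measurable_expR_sqr.
  move=> t; rewrite normrM mulr_ile1//.
  rewrite ger0_norm ?expR_ge0// -expR0 ler_expR oppr_le0 divr_ge0// mulr_ge0//.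
  exact: sqr_ge0.
apply: eq_Rintegral => t _.
transitivity (\int[P]_w (2^-1 * (Y w * cos (t * X w + Z w + (th - t * p)) +
    Y w * cos (- t * X w + Z w + (th + t * p))))).
  apply: eq_Rintegral => w _; rewrite /f/=.
  have -> : t * X w + Z w + (th - t * p) = t * (X w - p) + (Z w + th) by ring.
  have -> : - t * X w + Z w + (th + t * p) = (Z w + th) - t * (X w - p) by ring.
  set a := t * (X w - p); set b := Z w + th.
  by rewrite (cosD a b) (cosB b a); field.
rewrite RintegralZl//; last first.
  rewrite (_ : _ \o _ = (EFin \o (fun w => Y w * cos (t * X w + Z w + (th - t *
    p)))%R) \+
    (EFin \o (fun w => Y w * cos (- t * X w + Z w + (th + t * p)))%R))%E;
      last by apply/funext.
  exact: integrableD.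
by rewrite RintegralD// !H (cosB th) (cosD th) sqrrN; field.
Qed.

End mixture.
(** * Expansions in an orthonormal basis *)

Section hilbert_basics.
Context {R : realType} (H : completeNormedModType R) (dot : {dot H for idfun}).

Lemma dotC (u v : H) : dot u v = dot v u.
Proof. by rewrite (@hermC _ _ _ _ dot) expr0 mul1r. Qed.

Lemma dotZr (a : R) (u v : H) : dot u (a *: v) = a * dot u v.
Proof. exact: linearZr_LR. Qed.

Lemma dotZl (a : R) (u v : H) : dot (a *: u) v = a * dot u v.
Proof. by rewrite dotC dotZr dotC. Qed.

Lemma dotDr (u v w : H) : dot u (v + w) = dot u v + dot u w.
Proof. exact: linearDr. Qed.

Lemma dotDl (u v w : H) : dot (u + v) w = dot u w + dot v w.
Proof. by rewrite dotC dotDr dotC (dotC w). Qed.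

Lemma dotBl (u v w : H) : dot (u - v) w = dot u w - dot v w.
Proof. by rewrite -scaleN1r dotDl dotZl mulN1r. Qed.

Lemma dot0l (u : H) : dot 0 u = 0.
Proof. by rewrite -(scale0r 0) dotZl mul0r. Qed.

Lemma dot_sumr I (r : seq I) (P : pred I) (E : I -> H) (u : H) :
  dot u (\sum_(i <- r | P i) E i) = \sum_(i <- r | P i) dot u (E i).
Proof. exact: linear_sumr. Qed.

Lemma dot_suml I (r : seq I) (P : pred I) (E : I -> H) (u : H) :
  dot (\sum_(i <- r | P i) E i) u = \sum_(i <- r | P i) dot (E i) u.
Proof. by rewrite dotC dot_sumr; apply: eq_bigr => i _; rewrite dotC. Qed.

Lemma dot_ge0 (u : H) : 0 <= dot u u.
Proof.
by have [->|u0] := eqVneq u 0; [rewrite dot0l|rewrite ltW// neq0_dnorm_gt0].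
Qed.

End hilbert_basics.

Section expansion.
Context {R : realType} (H1 H2 : completeNormedModType R)
  (dot1 : {dot H1 for idfun}) (dot2 : {dot H2 for idfun}).
Hypothesis norm2 : forall x : H2, `|x| = Num.sqrt (dot2 x x).
Variables (e : nat -> H1) (e_basis : orthonormal_basis dot1 e).
Variables (A : {linear H1 -> H2}) (c : nat -> R).
Hypothesis A_cont : continuous A.
Hypothesis A_orth : forall j k, dot2 (A (e j)) (A (e k)) = (j == k)%:R * c k.

(** Parseval's identity for the image under A; with A the identity it is the
    usual one. *)
Lemma cvg_sqr_norm (f : H1) :
  [series dot1 f (e k) ^+ 2 * c k]_k @ \oo --> `|A f| ^+ 2.
Proof.
have [_ /(_ f) fE] := e_basis.
have AE : `|A ([series dot1 f (e k) *: e k]_k m)| ^+ 2 @[m --> \oo] --> `|A f|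
  ^+ 2.
  have h : `|A ([series dot1 f (e k) *: e k]_k m)| @[m --> \oo] --> `|A f|.
    apply: cvg_norm; apply: (cvg_comp _ _ fE); exact: A_cont.
  by rewrite expr2; under eq_fun do rewrite expr2; exact: cvgM.
move: AE; rewrite (_ : (fun m => _) = [series dot1 f (e k) ^+ 2 * c k]_k)//.
apply/funext => m; rewrite norm2 sqr_sqrtr ?dot_ge0// /series/=.
have AZ a x : A (a *: x) = a *: A x by exact: linearZ.
rewrite linear_sum dot_suml; apply: eq_big_nat => j /andP[_ jm].
rewrite dot_sumr (bigD1_seq j)/= ?mem_index_iota ?iota_uniq//= big1 ?addr0.
  by rewrite AZ dotZl dotZr A_orth eqxx mul1r mulrA expr2.
move=> k kj; rewrite !AZ dotZl dotZr A_orth eq_sym (negbTE kj).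
by rewrite mul0r !mulr0.
Qed.

End expansion.

(** * Coordinates of the Gaussian prior *)

Section prior.
Context {R : realType} (H : completeNormedModType R) (dot : {dot H for idfun}).
Variables (e : nat -> H) (Lambda : {linear H -> H}) (v : nat -> R).
Variable (Pi : probability (borel H) R).
Hypothesis e_orth : orthonormal_sequence dot e.
Hypothesis v_ge0 : forall k, 0 <= v k.
Hypothesis Lambda_e : forall k, Lambda (e k) = v k *: e k.
Hypothesis Pi_gaussian : gaussian_measure dot Lambda Pi.

(** Only <f, h> for a single h is needed: linear combinations of coordinates
    are of this form by bilinearity. *)
Lemma prior_coordinate (h : H) :
  [/\ measurable_fun setT (fun f : borel H => dot f h),
      forall th, \int[Pi]_f cos (dot f h + th) =
        cos th * expR (- (dot h (Lambda h) / 2)) &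
      0 < dot h (Lambda h) ->
      (\int[Pi]_f (expR ((dot h (Lambda h) *+ 4)^-1 * dot f h ^+ 2))%:E =
        (Num.sqrt 2)%:E)%E].
Proof.
have [_ [G E C]] := Pi_gaussian.
apply: gaussian_rv_centered (E h) (C h h).
have := G 1 (fun=> 1) (fun=> h).
by rewrite (_ : (fun w => _) = (fun f => dot f h))//; apply/funext => f;
  rewrite big_ord1 mul1r.
Qed.

Lemma measurable_coordinate (h : H) : measurable_fun setT (fun f : borel H =>
  dot f h).
Proof. by have [] := prior_coordinate h. Qed.

(** Coordinates are moved one by one from the cosine into the product.  The
    vector h is kept orthogonal to the coordinates already moved, so that
    adding t e_m to it changes <h, Lambda h> by t^2 v_m only. *)
Lemma integral_prod_bump (c p : nat -> R) (m : nat) (h : H) (th : R) :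
  (forall k, 0 < c k) -> (forall k, (k < m)%N -> dot h (e k) = 0) ->
  \int[Pi]_f (\prod_(k < m) expR (- (c k * (dot f (e k) - p k) ^+ 2 / 2)) *
    cos (dot f h + th)) =
  (\prod_(k < m) bump_mean (c k) (p k) (v k)) * cos th *
    expR (- (dot h (Lambda h) / 2)).
Proof.
move=> c0; elim: m h th => [|m IH] h th hm.
  rewrite !big_ord0 mul1r; have [_ <- _] := prior_coordinate h.
  by apply: eq_Rintegral => f _; rewrite big_ord0 mul1r.
pose Y (f : borel H) := \prod_(k < m) expR (- (c k * (dot f (e k) -
  p k) ^+ 2 / 2)).
have mbump k : measurable_fun setT (fun f : borel H => expR (- (c k *
  (dot f (e k) - p k) ^+ 2 / 2))).
  apply: measurableT_comp => //; apply: measurableT_comp => //.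
  apply: measurable_funM => //; apply: measurable_funM => //.
  apply: measurable_funX; apply: measurable_funB => //.
  exact: measurable_coordinate.
have mY : measurable_fun setT Y by exact: measurable_prod.
have Y1 f : `|Y f| <= 1.
  rewrite ger0_norm; last by apply: prodr_ge0 => k _; exact: expR_ge0.
  apply: prodr_ile1 => k _; rewrite expR_ge0/= -expR0 ler_expR oppr_le0.
  by rewrite divr_ge0// mulr_ge0 ?sqr_ge0// ltW.
have := @integral_bump R _ _ Pi Y (fun f => dot f (e m)) (fun f => dot f h) 1
  (c m) (p m) (v m)
  ((\prod_(k < m) bump_mean (c k) (p k) (v k)) *
    expR (- (dot h (Lambda h) / 2)))
  (c0 m) (v_ge0 m) mY (measurable_coordinate _) (measurable_coordinate _) Y1.
move=> K; rewrite big_ord_recr/= [in RHS]mulrAC [in RHS](mulrAC _ (bump_mean _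
  _ _)) -K.
  by apply: eq_Rintegral => f _; rewrite big_ord_recr.
move=> t th'.
have hm0 : dot h (e m) = 0 by exact: hm.
have := IH (t *: e m + h) th'.
have -> : dot (t *: e m + h) (Lambda (t *: e m + h)) =
  t ^+ 2 * v m + dot h (Lambda h).
  have [[_ sym _ _] _] := Pi_gaussian.
  rewrite linearD linearZ/= Lambda_e !(dotDl, dotDr, dotZl, dotZr) hm0.
  rewrite e_orth eqxx mulr1n -sym Lambda_e dotZl dotC hm0.
  by ring.
rewrite mulrDl opprD expRD => IHm.
rewrite [RHS](_ : _ = \prod_(k < m) bump_mean (c k) (p k) (v k) * cos th' *
  (expR (- (t ^+ 2 * v m / 2)) * expR (- (dot h (Lambda h) / 2))));
    last by ring.
rewrite -IHm.
  apply: eq_Rintegral => f _; rewrite /Y dotDr dotZr.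
  by [].
move=> k km; rewrite dotDl dotZl e_orth hm ?(leq_trans km)// gtn_eqF// mulr0
  addr0//.
Qed.

End prior.
Section domination.
Context {R : realType}.

(** Jensen's inequality, the missing mass 1 - sum w being put at 0.  It follows
    from the tangent line of the exponential at sum w z. *)
Lemma expR_sum_le (w z : nat -> R) (m : nat) :
  (forall k, 0 <= w k) -> \sum_(k < m) w k <= 1 ->
  expR (\sum_(k < m) w k * z k) <= 1 + \sum_(k < m) w k * expR (z k).
Proof.
move=> w0 w1; set b := \sum_(k < m) w k * z k; set W := \sum_(k < m) w k.
have H : W * (expR b * (1 - b)) + expR b * b <= \sum_(k < m) w k * expR (z k).
  rewrite /W mulr_suml /b mulr_sumr -big_split/=.
  apply: ler_sum => k _; rewrite -/b.
  have -> : w k * (expR b * (1 - b)) + expR b * (w k * z k) =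
    w k * (expR b * (1 + (z k - b))) by ring.
  rewrite ler_wpM2l//.
  have -> : expR (z k) = expR b * expR (z k - b) by rewrite -expRD subrKC.
  by rewrite ler_wpM2l ?expR_ge0// expR_ge1Dx.
have H0 : expR b * (1 - b) <= 1.
  rewrite -[leRHS](expRxMexpNx_1 b) ler_wpM2l ?expR_ge0//.
  exact: expR_ge1Dx.
have : (1 - W) * (expR b * (1 - b)) <= 1.
  apply: le_trans (_ : (1 - W) * 1 <= _); first by rewrite ler_wpM2l// subr_ge0.
  rewrite mulr1 gerBl; exact: sumr_ge0.
lra.
Qed.

End domination.

Section prior_domination.
Context {R : realType} (H : completeNormedModType R) (dot : {dot H for idfun}).
Variables (e : nat -> H) (Lambda : {linear H -> H}) (v : nat -> R).
Variable (Pi : probability (borel H) R).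
Hypothesis e_orth : orthonormal_sequence dot e.
Hypothesis v_gt0 : forall k, 0 < v k.
Hypothesis Lambda_e : forall k, Lambda (e k) = v k *: e k.
Hypothesis Pi_gaussian : gaussian_measure dot Lambda Pi.

Lemma prior_exp_sqr k :
  (\int[Pi]_f (expR ((v k *+ 4)^-1 * dot f (e k) ^+ 2))%:E = (Num.sqrt 2)%:E)%E.
Proof.
have [_ _] := prior_coordinate Pi_gaussian (e k).
by rewrite Lambda_e dotZr e_orth eqxx mulr1; exact.
Qed.

(** With weights proportional to a_k sqrt(v_k), Jensen's inequality bounds the
    exponential of the sum by a weighted sum of exponentials of a single
    coordinate each, so no joint law is needed.  The inequality
    S y <= S^2 + y^2 / 4 leads back to Gaussian exponential moments. *)
Lemma prior_domination (a : nat -> R) : (forall k, 0 <= a k) ->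
  (\sum_(0 <= k <oo) (a k * Num.sqrt (v k))%:E < +oo)%E ->
  exists G : H -> \bar R, Pi.-integrable setT (G : borel H -> \bar R) /\
    forall f m, ((expR (\sum_(k < m) a k * `|dot f (e k)|))%:E <= G f)%E.
Proof.
move=> a0 aoo.
have at0 k : 0 <= a k * Num.sqrt (v k) by rewrite mulr_ge0// sqrtr_ge0.
(* the summand 1 makes S positive even when all a_k vanish *)
pose S := 1 + fine (\sum_(0 <= k <oo) (a k * Num.sqrt (v k))%:E)%E.
have SE : (\sum_(0 <= k <oo) (a k * Num.sqrt (v k))%:E = (S - 1)%:E)%E.
  rewrite /S addrC addKr fineK// ge0_fin_numE//.
  by apply: nneseries_ge0 => k _ _; rewrite lee_fin.
have S1 : 1 <= S.
  rewrite /S lerDl fine_ge0//; apply: nneseries_ge0 => k _ _;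
    by rewrite lee_fin.
have S0 : 0 < S by lra.
pose w k := a k * Num.sqrt (v k) / S.
have w0 k : 0 <= w k by rewrite divr_ge0// ltW.
have wle m : \sum_(k < m) w k <= 1.
  rewrite -mulr_suml ler_pdivrMr// mul1r.
  suff : \sum_(k < m) a k * Num.sqrt (v k) <= S - 1 by lra.
  rewrite -lee_fin -SE -sumEFin -(big_mkord xpredT (fun k => (a k *
    Num.sqrt (v k))%:E)).
  by apply: nneseries_lim_ge => k _ _; rewrite lee_fin.
pose g k (f : borel H) := (w k * expR (S ^+ 2) * expR ((v k *+ 4)^-1 *
  dot f (e k) ^+ 2)).
have g0 k f : 0 <= g k f by rewrite /g mulr_ge0 ?expR_ge0// mulr_ge0 ?expR_ge0.
have mg k : measurable_fun setT (g k).
  apply: measurable_funM => //; apply: measurableT_comp => //.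
  apply: measurable_funM => //; apply: measurable_funX.
  by have [] := prior_coordinate Pi_gaussian (e k).
pose G (f : borel H) := (1 + \sum_(0 <= k <oo) (g k f)%:E)%E.
have mG1 : measurable_fun setT (fun f : borel H => (\sum_(0 <=
  k <oo) (g k f)%:E)%E).
  apply: ge0_emeasurable_sum => [k f _ _|k _]; first by rewrite lee_fin.
  exact/measurable_EFinP.
have G0 (f : borel H) : (0 <= \sum_(0 <= k <oo) (g k f)%:E)%E.
  by apply: nneseries_ge0 => k _ _; rewrite lee_fin.
exists G; split.
  rewrite /G; apply: integrableD => //.
    exact: finite_measure_integrable_cst.
  apply/integrableP; split => //.
  under eq_integral do rewrite gee0_abs//.
  rewrite integral_nneseries//; last 2 first.
  - by move=> k; exact/measurable_EFinP.
  - by move=> k f _; rewrite lee_fin.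
  have E k : (\int[Pi]_f (g k f)%:E = (Num.sqrt 2 * expR (S ^+ 2) / S * (a k *
    Num.sqrt (v k)))%:E)%E.
    under eq_integral do rewrite /g EFinM.
    rewrite ge0_integralZl//.
    - rewrite prior_exp_sqr -EFinM /w; congr EFin; ring.
    - apply/measurable_EFinP; apply: measurableT_comp => //.
      apply: measurable_funM => //; apply: measurable_funX.
      by have [] := prior_coordinate Pi_gaussian (e k).
    - by rewrite lee_fin mulr_ge0.
  under eq_eseriesr do rewrite E EFinM.
  rewrite nneseriesZl; last by move=> k _; rewrite lee_fin.
  by rewrite SE -EFinM ltry.
move=> f m; rewrite /G.
apply: (@le_trans _ _ (1 + \sum_(k < m) (g k f)%:E)%E); last first.
  rewrite leeD2l// -(big_mkord xpredT (fun k => (g k f)%:E)).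
  by apply: nneseries_lim_ge => k _ _; rewrite lee_fin.
rewrite sumEFin lee_fin.
have t0 k : 0 < Num.sqrt (v k) by rewrite sqrtr_gt0.
have -> : \sum_(k < m) a k * `|dot f (e k)| =
    \sum_(k < m) w k * (S * `|dot f (e k)| / Num.sqrt (v k)).
  by apply: eq_bigr => k _; rewrite /w; field; rewrite !gt_eqF.
apply: (le_trans (expR_sum_le (fun k => S * `|dot f (e k)| / Num.sqrt (v k)) w0
  (wle m))).
rewrite lerD2l; apply: ler_sum => k _; rewrite /g -[leRHS]mulrA ler_wpM2l//
  -expRD ler_expR.
have -> : (v k *+ 4)^-1 * dot f (e k) ^+ 2 = (`|dot f (e k)| / Num.sqrt (v k))
  ^+ 2 / 4.
  rewrite expr_div_n real_normK ?num_real// sqr_sqrtr ?ltW//; field.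
  by rewrite gt_eqF.
rewrite -mulrA; set y := `|_| / _.
by have := sqr_ge0 (S - y / 2); rewrite !expr2; nra.
Qed.

End prior_domination.
(** * Quadratic tilts of the prior *)

Section real_dominated.
Context {R : realType} d (T : measurableType d) (P : probability T R).

Lemma Rintegral_dominated_cvg (u : nat -> T -> R) (l : T -> R) (G : T ->
  \bar R) :
  (forall m, measurable_fun setT (u m)) -> measurable_fun setT l ->
  P.-integrable setT G -> (forall m w, (`|u m w|%:E <= G w)%E) ->
  (forall w, G w \is a fin_num -> u ^~ w @ \oo --> l w) ->
  P.-integrable setT (EFin \o l) /\
  \int[P]_w u m w @[m --> \oo] --> \int[P]_w l w.
Proof.
move=> mu ml iG uG ul.
have [||||| il _ cv] := @dominated_convergence _ _ _ P setT measurableT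
  (fun m w => (u m w)%:E) (EFin \o l) G.
- by move=> m; exact/measurable_EFinP.
- exact/measurable_EFinP.
- have := integrable_ae measurableT iG; apply: filterS => w /(_ I) Gw _.
  by apply: cvg_EFin; [exact: nearW|exact: ul].
- by [].
- by apply: aeW => w m _; exact: uG.
split => //; apply: fine_cvg.
rewrite fineK; first exact: cv.
exact: integrable_fin_num.
Qed.

End real_dominated.

Section quadratic.
Context {R : realType}.

(** E exp (b X - c X^2 / 2) for X ~ N(0, v) *)
Definition tilt (b c v : R) : R :=
  (Num.sqrt (1 + c * v))^-1 * expR (b ^+ 2 * v / (1 + c * v) / 2).

Lemma tilt_bump (b c v : R) : 0 < c -> 0 <= v ->
  expR (b ^+ 2 / c / 2) * bump_mean c (b / c) v = tilt b c v.
Proof.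
move=> c0 v0; rewrite /bump_mean mulrCA -expRD; congr (_ * expR _).
have : 0 < 1 + c * v by rewrite ltr_wpDr// mulr_ge0// ltW.
by move=> cv; field; rewrite !gt_eqF.
Qed.

Lemma tilt_ge0 b c v : 0 <= tilt b c v.
Proof. by rewrite mulr_ge0 ?expR_ge0// invr_ge0 sqrtr_ge0. Qed.

(** Divided by tilt b c v, the right-hand side is the mean of
    exp(-eps (X - a)^2 / 2) for the tilted normal law of X, of variance
    p = v / (1 + c v) and mean b p; the left-hand side is the exponential of
    the mean, as in Jensen's inequality.  Both are explicit. *)
Lemma tilt_compare (b c v eps a : R) : 0 < c -> 0 < v -> 0 < eps ->
  tilt b c v * expR (- (eps / 2 * (v / (1 + c * v) + (b * v / (1 + c * v) -
    a) ^+ 2))) <=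
  tilt (b + eps * a) (c + eps) v * expR (- (eps * a ^+ 2 / 2)).
Proof.
move=> c0 v0 e0.
have cv : 0 < 1 + c * v by rewrite ltr_wpDr// mulr_ge0// ltW.
set p := v / (1 + c * v).
have p0 : 0 < p by rewrite divr_gt0.
have ep : 0 < 1 + eps * p by rewrite ltr_wpDr// mulr_ge0// ltW.
have E1 : 1 + (c + eps) * v = (1 + c * v) * (1 + eps * p).
  by rewrite /p; field; rewrite gt_eqF.
rewrite /tilt E1 (sqrtrM _ (ltW cv)) invfM -[leLHS]mulrA -[leRHS]mulrA
  -[leRHS]mulrA ler_wpM2l ?invr_ge0 ?sqrtr_ge0//.
rewrite -!expRD.
have H : expR (- (eps * p / 2)) <= (Num.sqrt (1 + eps * p))^-1.
  rewrite expRN lef_pV2 ?posrE ?expR_gt0 ?sqrtr_gt0//.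
  rewrite -[leRHS](ger0_norm (expR_ge0 _)) -[leRHS]sqrtr_sqr ler_sqrt
    ?sqr_ge0//.
  rewrite -expRM_natl; apply: le_trans (expR_ge1Dx _) _.
  by rewrite ler_expR; lra.
apply: (@le_trans _ _ (expR (- (eps * p / 2)) * expR ((b + eps * a) ^+ 2 *
  v / ((1 + c * v) * (1 + eps * p)) / 2 - eps * a ^+ 2 / 2))).
  rewrite -expRD ler_expR.
  have -> : (b + eps * a) ^+ 2 * v / ((1 + c * v) * (1 + eps * p)) / 2 - eps *
    a ^+ 2 / 2 =
    b ^+ 2 * p / 2 - eps / 2 * (b * p - a) ^+ 2 / (1 + eps * p).
    rewrite /p; field; apply/andP; split; rewrite gt_eqF//.
    by rewrite addr_gt0// mulr_gt0.
  have : eps / 2 * (b * p - a) ^+ 2 / (1 + eps * p) <=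
    eps / 2 * (b * p - a) ^+ 2.
    rewrite ler_pdivrMr// ler_peMr//.
      by rewrite mulr_ge0 ?sqr_ge0// divr_ge0// ltW.
    by rewrite lerDl mulr_ge0// ltW.
  have -> : b ^+ 2 * v / (1 + c * v) / 2 = b ^+ 2 * p / 2 by rewrite /p !mulrA.
  have -> : b * v / (1 + c * v) = b * p by rewrite /p mulrA.
  lra.
by rewrite ler_wpM2r ?expR_ge0.
Qed.

End quadratic.
Section quadratic_tilts.
Context {R : realType} (H : completeNormedModType R) (dot : {dot H for idfun}).
Hypothesis norm2 : forall x : H, `|x| = Num.sqrt (dot x x).
Variables (e : nat -> H) (Lambda : {linear H -> H}) (v : nat -> R).
Variable (Pi : probability (borel H) R).
Hypothesis e_basis : orthonormal_basis dot e.
Hypothesis v_gt0 : forall k, 0 < v k.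
Hypothesis Lambda_e : forall k, Lambda (e k) = v k *: e k.
Hypothesis Pi_gaussian : gaussian_measure dot Lambda Pi.

Let e_orth : orthonormal_sequence dot e. Proof. by case: e_basis. Qed.

Lemma integrable_quadratic (b c : nat -> R) (m : nat) : (forall k, 0 < c k) ->
  Pi.-integrable setT (EFin \o (fun f : borel H =>
    expR (\sum_(k < m) (b k * dot f (e k) - c k * dot f (e k) ^+ 2 / 2)))).
Proof.
move=> c0.
have mc k : measurable_fun setT (fun f : borel H => dot f (e k)).
  exact: (measurable_coordinate Pi_gaussian).
apply: (@integrable_bounded _ _ _ _ _ (expR (\sum_(k < m) b k ^+ 2 / c k / 2))).
  apply: measurableT_comp => //; apply: measurable_sum => k.
  apply: measurable_funB; first exact: measurable_funM.
  by apply: measurable_funM => //; apply: measurable_funM => //;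
    exact: measurable_funX.
move=> f; rewrite ger0_norm ?expR_ge0// ler_expR; apply: ler_sum => k _.
rewrite -subr_ge0; set x := dot f _.
have -> : b k ^+ 2 / c k / 2 - (b k * x - c k * x ^+ 2 / 2) =
  (c k * x - b k) ^+ 2 / c k / 2 by field; rewrite gt_eqF.
by rewrite !divr_ge0 ?sqr_ge0// ltW.
Qed.

Lemma integral_quadratic (b c : nat -> R) (m : nat) : (forall k, 0 < c k) ->
  \int[Pi]_f expR (\sum_(k < m) (b k * dot f (e k) - c k *
    dot f (e k) ^+ 2 / 2)) =
  \prod_(k < m) tilt (b k) (c k) (v k).
Proof.
move=> c0.
have v0 k : 0 <= v k by exact: ltW.
have := integral_prod_bump e_orth v0 Lambda_e Pi_gaussian (c :=
  c) (fun k => b k / c k) (m := m) (h := 0) 0 c0.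
rewrite cos0 mulr1 dot0l mul0r oppr0 expR0 mulr1 => /(_ _) E.
pose K := \prod_(k < m) expR (b k ^+ 2 / c k / 2).
have IB : Pi.-integrable setT (EFin \o (fun f : borel H =>
    \prod_(k < m) expR (- (c k * (dot f (e k) - b k / c k) ^+ 2 / 2)))).
  apply: (@integrable_bounded _ _ _ _ _ 1).
    apply: measurable_prod => k _.
    apply: measurableT_comp => //; apply: measurableT_comp => //.
    apply: measurable_funM => //; apply: measurable_funM => //.
    apply: measurable_funX; apply: measurable_funB => //.
    exact: (measurable_coordinate Pi_gaussian).
  move=> f; rewrite ger0_norm; last by apply: prodr_ge0 => k _; exact: expR_ge0.
  apply: prodr_ile1 => k _; rewrite expR_ge0/= -expR0 ler_expR oppr_le0.
  by rewrite divr_ge0// mulr_ge0 ?sqr_ge0// ltW.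
transitivity (K * \prod_(k < m) bump_mean (c k) (b k / c k) (v k)); last first.
  by rewrite /K -big_split/=; apply: eq_bigr => k _; exact: tilt_bump.
rewrite -E; last by move=> k _; rewrite dot0l.
have -> : \int[Pi]_x (\prod_(k < m) expR (- (c k * (dot x (e k) -
  b k / c k) ^+ 2 / 2)) * cos (dot x 0 + 0)) =
   \int[Pi]_x (\prod_(k < m) expR (- (c k * (dot x (e k) -
     b k / c k) ^+ 2 / 2))).
  by apply: eq_Rintegral => f _; rewrite dotC dot0l addr0 cos0 mulr1.
rewrite -RintegralZl//; apply: eq_Rintegral => f _.
rewrite /K -big_split/= expR_sum; apply: eq_bigr => k _.
by rewrite -expRD; congr expR; field; rewrite gt_eqF.
Qed.

Lemma cvg_sqr_dist (f f0 : H) :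
  [series (dot f (e k) - dot f0 (e k)) ^+ 2]_k @ \oo --> `|f - f0| ^+ 2.
Proof.
rewrite (_ : [series _]_k = [series dot (f - f0) (e k) ^+ 2 * 1]_k).
  apply: (@cvg_sqr_norm R H H dot dot norm2 e e_basis idfun (fun=> 1)).
    by move=> x; exact: cvg_id.
  by move=> j k; rewrite mulr1 e_orth.
apply/funext => m; rewrite /series/=; apply: eq_bigr => k _.
by rewrite mulr1 dotBl.
Qed.

Lemma measurable_dist (f0 : H) : measurable_fun setT (fun f : borel H => `|f -
  f0| ^+ 2).
Proof.
apply: (measurable_fun_cvg (h := fun m (f : borel H) => [series (dot f (e k) -
  dot f0 (e k)) ^+ 2]_k m)).
  move=> m; apply: measurable_sum => k; apply: measurable_funX;
    apply: measurable_funB => //.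
  exact: (measurable_coordinate Pi_gaussian).
by move=> f _; exact: cvg_sqr_dist.
Qed.

End quadratic_tilts.
Section tilting.
Context {R : realType} (H : completeNormedModType R) (dot : {dot H for idfun}).
Hypothesis norm2 : forall x : H, `|x| = Num.sqrt (dot x x).
Variables (e : nat -> H) (Lambda : {linear H -> H}) (v : nat -> R).
Variable (Pi : probability (borel H) R).
Hypothesis e_basis : orthonormal_basis dot e.
Hypothesis v_gt0 : forall k, 0 < v k.
Hypothesis Lambda_e : forall k, Lambda (e k) = v k *: e k.
Hypothesis Pi_gaussian : gaussian_measure dot Lambda Pi.

Variables (b c : nat -> R) (L C : H -> R).
Hypothesis c_gt0 : forall k, 0 < c k.
Hypothesis b_sum : (\sum_(0 <= k <oo) (`|b k| * Num.sqrt (v k))%:E < +oo)%E.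
Hypothesis mL : measurable_fun setT (L : borel H -> R).
Hypothesis cvgC : forall f, [series c k * dot f (e k) ^+ 2]_k @ \oo --> C f.
Hypothesis LE : forall f, cvgn [series b k * dot f (e k)]_k ->
  L f = expR (limn [series b k * dot f (e k)]_k - C f / 2).

(** L is the limit of exponentials of finite quadratic forms.  For these the
    integrals are products of tilts, compared factor by factor; domination
    passes the comparison to the limit. *)
Lemma tilted_prior_dist (f0 : H) (eps Q : R) : 0 < eps ->
  (forall m, \sum_(k < m) (v k / (1 + c k * v k) +
     (b k * v k / (1 + c k * v k) - dot f0 (e k)) ^+ 2) <= Q) ->
  [/\ Pi.-integrable setT (EFin \o (L : borel H -> R)),
    Pi.-integrable setT (EFin \o (fun f : borel H => L f * expR (- (eps / 2 *
      `|f - f0| ^+ 2)))) &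
    expR (- (eps / 2 * Q)) * \int[Pi]_f L f <=
    \int[Pi]_f (L f * expR (- (eps / 2 * `|f - f0| ^+ 2)))].
Proof.
move=> eps0 qQ.
have [e_orth _] := e_basis.
have mc k : measurable_fun setT (fun f : borel H => dot f (e k)).
  exact: (measurable_coordinate Pi_gaussian).
have [G [iG GE]] := prior_domination e_orth v_gt0 Lambda_e Pi_gaussian
  (fun k => normr_ge0 (b k)) b_sum.
pose U m (f : borel H) := \sum_(k < m) (b k * dot f (e k) - c k *
  dot f (e k) ^+ 2 / 2).
pose D m (f : borel H) := \sum_(k < m) (dot f (e k) - dot f0 (e k)) ^+ 2.
have mU m : measurable_fun setT (U m).
  apply: measurable_sum => k; apply: measurable_funB;
    first exact: measurable_funM.
  by apply: measurable_funM => //; apply: measurable_funM => //;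
    exact: measurable_funX.
have mD m : measurable_fun setT (D m).
  by apply: measurable_sum => k; apply: measurable_funX; exact: measurable_funB.
have UG m f : ((expR (U m f))%:E <= G f)%E.
  apply: le_trans (GE f m); rewrite lee_fin ler_expR; apply: ler_sum => k _.
  apply: (@le_trans _ _ (b k * dot f (e k))).
    by rewrite gerBl divr_ge0// mulr_ge0 ?sqr_ge0// ltW.
  by rewrite -normrM ler_norm.
have cvU f : G f \is a fin_num -> expR (U m f) @[m --> \oo] --> L f.
  move=> Gf.
  have cb : cvgn [series b k * dot f (e k)]_k.
    apply: normed_cvg; apply: nondecreasing_is_cvgn.
      by apply: nondecreasing_series => k _ _; exact: normr_ge0.
    exists (fine (G f)) => _ [m _ <-].
    rewrite /= /series/= big_mkord.
    rewrite -lee_fin fineK//; apply: le_trans (GE f m).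
    rewrite lee_fin; under eq_bigr do rewrite normrM.
    by apply: le_trans (expR_ge1Dx _); rewrite lerDr.
  rewrite LE//.
  apply: (cvg_comp (fun m => U m f) expR); last exact: continuous_expR.
  rewrite (_ : (fun m => U m f) = (fun m => [series b k * dot f (e k)]_k m -
    [series c k * dot f (e k) ^+ 2]_k m / 2)).
    apply: cvgB; first exact: cb.
    by apply: cvgM; [exact: cvgC|exact: cvg_cst].
  apply/funext => m; rewrite /U /series/= !big_mkord sumrB; congr (_ - _).
  by rewrite mulr_suml.
have mbound : measurable_fun setT (fun f : borel H => expR (- (eps / 2 * `|f -
  f0| ^+ 2))).
  apply: measurableT_comp => //; apply: measurableT_comp => //.
  apply: measurable_funM => //.
  exact: (measurable_dist norm2 e_basis Pi_gaussian).
have [iL cvL] : Pi.-integrable setT (EFin \o (L : borel H -> R)) /\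
    \int[Pi]_f expR (U m f) @[m --> \oo] --> \int[Pi]_f L f.
  apply: (@Rintegral_dominated_cvg _ _ (borel H) Pi (fun m f => expR (U m f)) L
    G) => //.
  - by move=> m; exact: measurableT_comp.
  - by move=> m f; rewrite ger0_norm ?expR_ge0// UG.
have [iL' cvL'] : Pi.-integrable setT (EFin \o (fun f : borel H => L f *
  expR (- (eps / 2 * `|f - f0| ^+ 2)))) /\
    \int[Pi]_f (expR (U m f) * expR (- (eps / 2 * D m f))) @[m --> \oo] -->
    \int[Pi]_f (L f * expR (- (eps / 2 * `|f - f0| ^+ 2))).
  apply: (@Rintegral_dominated_cvg _ _ (borel H) Pi
    (fun m f => expR (U m f) * expR (- (eps / 2 * D m f)))
    (fun f => L f * expR (- (eps / 2 * `|f - f0| ^+ 2))) G) => //.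
  - move=> m; apply: measurable_funM; first exact: measurableT_comp.
    apply: measurableT_comp => //; apply: measurableT_comp => //.
    exact: measurable_funM.
  - exact: measurable_funM.
  - move=> m f; rewrite ger0_norm ?mulr_ge0 ?expR_ge0//.
    apply: le_trans (UG m f); rewrite lee_fin ler_piMr ?expR_ge0//.
    rewrite -expR0 ler_expR oppr_le0 mulr_ge0 ?divr_ge0 ?(ltW eps0)//.
    by apply: sumr_ge0 => k _; exact: sqr_ge0.
  - move=> f Gf; apply: cvgM; first exact: cvU.
    apply: (cvg_comp (fun m => - (eps / 2 * D m f)) expR);
      last exact: continuous_expR.
    apply: cvgN; apply: cvgM; first exact: cvg_cst.
    rewrite (_ : (fun m => D m f) = [series (dot f (e k) -
      dot f0 (e k)) ^+ 2]_k).
      exact: (cvg_sqr_dist norm2 e_basis).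
    by apply/funext => m; rewrite /D /series/= big_mkord.
split => //.
apply: (@ler_cvg_to _ _ _ _ (fun m => expR (- (eps / 2 * Q)) *
  \int[Pi]_f expR (U m f)) _ _ _ _ cvL').
  by apply: cvgM; [exact: cvg_cst|exact: cvL].
apply: nearW => m; rewrite (integral_quadratic e_basis v_gt0 Lambda_e
  Pi_gaussian)//.
have -> : \int[Pi]_f (expR (U m f) * expR (- (eps / 2 * D m f))) =
    (\prod_(k < m) expR (- (eps * dot f0 (e k) ^+ 2 / 2))) *
    \int[Pi]_f expR (\sum_(k < m) ((b k + eps * dot f0 (e k)) * dot f (e k) -
       (c k + eps) * dot f (e k) ^+ 2 / 2)).
  rewrite -RintegralZl//; last first.
    apply: (@integrable_quadratic _ _ _ e _ _ Pi_gaussian (fun k => b k + eps *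
      dot f0 (e k)) (fun k => c k + eps) m) => k.
    by rewrite addr_gt0.
  apply: eq_Rintegral => f _.
  rewrite -expR_sum -!expRD; congr expR.
  rewrite /U /D mulr_sumr -sumrN -!big_split/=; apply: eq_bigr => k _.
  by field.
rewrite (integral_quadratic e_basis v_gt0 Lambda_e Pi_gaussian (fun k => b k +
  eps * dot f0 (e k)) (c := fun k => c k + eps)); last first.
  by move=> k; rewrite addr_gt0.
apply: (@le_trans _ _ (\prod_(k < m) (tilt (b k) (c k) (v k) *
  expR (- (eps / 2 * (v k / (1 + c k * v k) + (b k * v k / (1 + c k * v k) -
    dot f0 (e k)) ^+ 2)))))).
  rewrite [leRHS]big_split/= [leLHS]mulrC ler_wpM2l//.
    by apply: prodr_ge0 => k _; exact: tilt_ge0.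
  rewrite -expR_sum ler_expR sumrN -mulr_sumr lerN2 ler_wpM2l ?qQ//.
  by rewrite divr_ge0// ltW.
rewrite [leRHS]mulrC -big_split/=; apply: ler_prod => k _.
rewrite mulr_ge0 ?expR_ge0 ?tilt_ge0//=.
exact: tilt_compare.
Qed.
End tilting.
(** * The posterior mass far from a point *)

Section support.
Context {R : realType} (H : completeNormedModType R) (Pi : probability (borel
  H) R).

Lemma open_measurable_borel (U : set H) : open U ->
  measurable (U : set (borel H)).
Proof. by move=> oU; apply: sub_sigma_algebra. Qed.

Lemma open_setC_support : open (~` measure_support Pi).
Proof.
rewrite (_ : ~` _ = \bigcup_(U in [set U : set H | open U /\ Pi U = 0%E]) U).
  by apply: bigcup_open => U [].
apply/seteqP; split => [f /existsNP[U /not_implyP[oU /not_implyP[Uf PiU]]]|f [U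
  [oU PiU] Uf] /(_ U oU Uf)].
  exists U => //; split => //; apply/eqP; rewrite eq_le measure_ge0 andbT.
  by rewrite leNgt; apply/negP.
by rewrite PiU ltxx.
Qed.

Lemma measurable_support : measurable (measure_support Pi : set (borel H)).
Proof.
rewrite -[X in measurable X]setCK; apply: measurableC.
apply: open_measurable_borel; exact: open_setC_support.
Qed.

(** The complement of the support is covered by null balls with centers in a
    countable dense set and radii 1 / (n + 1). *)
Lemma support_full : (exists2 D : set H, countable D & dense D) ->
  Pi (~` measure_support Pi) = 0%E.
Proof.
move=> [D /countable_injP[i iinj] dD].
have mS : measurable (~` measure_support Pi : set (borel H)).
  by apply: measurableC; exact: measurable_support.
apply: measure_negligible => //.
pose r n : R := n.+1%:R^-1.
have r0 n : 0 < r n by rewrite invr_gt0.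
(* i being injective on D, F k n is empty or a single null ball *)
pose F k n := [set f : H | exists d, [/\ D d, i d = k, Pi (ball d (r n)) =
  0%E & ball d (r n) f]].
apply: (@negligibleS _ _ _ _ (\bigcup_k \bigcup_n F k n : set (borel H))).
  move=> f /existsNP[U /not_implyP[oU /not_implyP[Uf PiU]]].
  have PU0 : Pi U = 0%E.
    by apply/eqP; rewrite eq_le measure_ge0 andbT leNgt; apply/negP.
  have /nbhs_ballP[eps /= eps0 epsU] : nbhs f U by exact: open_nbhs_nbhs.
  have [n rn] : exists n, r n < eps / 2.
    have e20 : 0 < eps / 2 by rewrite divr_gt0.
    have [n _ /(_ n (leqnn n))] := near_infty_natSinv_lt (PosNum e20).
    by exists n.
  have [d [fd Dd]] : (ball f (r n) `&` D) !=set0.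
    apply: dD; last exact: ball_open.
    by exists f; exact: ballxx.
  exists (i d) => //; exists n => //; exists d; split => //;
    last exact: ball_sym.
  apply/eqP; rewrite -measure_le0 -PU0 le_measure ?inE//.
  - by apply: open_measurable_borel; exact: ball_open.
  - exact: open_measurable_borel.
  - move=> g dg; apply: epsU; rewrite [eps]splitr.
    apply: ball_triangle; first exact: le_ball (ltW rn) _ fd.
    exact: le_ball (ltW rn) _ dg.
apply: negligible_bigcup => k; apply: negligible_bigcup => n.
have [[d [Dd idk Pd0]]|nd] := pselect (exists d, [/\ D d, i d = k &
  Pi (ball d (r n)) = 0%E]).
  exists (ball d (r n)); split => //.
    by apply: open_measurable_borel; exact: ball_open.
  move=> f [d' [Dd' id'k Pd'0 d'f]].
  suff -> : d = d' by [].
  by apply: iinj; rewrite ?inE// idk id'k.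
apply: negligibleS (negligible_set0 Pi) => f [d [Dd id' Pd0 _]].
by apply: nd; exists d.
Qed.

End support.
Section ratio.
Context {R : realType} (H : completeNormedModType R) (dot : {dot H for idfun}).
Hypothesis H_hilbert : separable_hilbert dot.
Variables (e : nat -> H) (Lambda : {linear H -> H}) (v : nat -> R).
Variable (Pi : probability (borel H) R).
Hypothesis e_basis : orthonormal_basis dot e.
Hypothesis v_gt0 : forall k, 0 < v k.
Hypothesis Lambda_e : forall k, Lambda (e k) = v k *: e k.
Hypothesis Pi_gaussian : gaussian_measure dot Lambda Pi.

Lemma measurable_far (f0 : H) (t : R) : 0 <= t ->
  measurable ([set f | t < `|f - f0|] : set (borel H)).
Proof.
move=> t0.
have mD := measurable_dist H_hilbert.1 e_basis Pi_gaussian f0.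
have := mD measurableT `]t ^+ 2, +oo[%classic (measurable_itv _).
rewrite setTI; congr measurable; apply/seteqP; split => f /=;
  rewrite in_itv/= andbT.
  by rewrite ltr_sqr ?nnegrE.
by rewrite ltr_sqr ?nnegrE.
Qed.

Variables (b c : nat -> R) (L C : H -> R).
Hypothesis c_gt0 : forall k, 0 < c k.
Hypothesis b_sum : (\sum_(0 <= k <oo) (`|b k| * Num.sqrt (v k))%:E < +oo)%E.
Hypothesis mL : measurable_fun setT (L : borel H -> R).
Hypothesis L_ge0 : forall f, 0 <= L f.
Hypothesis cvgC : forall f, [series c k * dot f (e k) ^+ 2]_k @ \oo --> C f.
Hypothesis LE : forall f, cvgn [series b k * dot f (e k)]_k ->
  L f = expR (limn [series b k * dot f (e k)]_k - C f / 2).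

(** With eps = 2 / t^2, the factor 1 - exp(-eps |f - f0|^2 / 2) is at least
    1 - 1/e at distance more than t, and its integral against L is at most
    1 - exp(-eps Q / 2) <= Q / t^2 times that of L. *)
Lemma posterior_ratio (f0 : H) (t Q : R) : 0 < t ->
  (forall m, \sum_(k < m) (v k / (1 + c k * v k) +
     (b k * v k / (1 + c k * v k) - dot f0 (e k)) ^+ 2) <= Q) ->
  (\int[Pi]_(f in [set f | t < `|f - f0|]) L f) / (\int[Pi]_(f in
    measure_support Pi) L f)
  <= (1 - expR (- 1))^-1 * (Q / t ^+ 2).
Proof.
move=> t0 qQ.
have t20 : 0 < t ^+ 2 by rewrite exprn_gt0.
have e0 : 0 < 2 / t ^+ 2 by rewrite divr_gt0.
have [iL iL' le] := tilted_prior_dist H_hilbert.1 e_basis v_gt0 Lambda_e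
  Pi_gaussian c_gt0 b_sum mL cvgC LE e0 qQ.
set B := [set f | _].
have mB : measurable (B : set (borel H)) by apply: measurable_far; exact: ltW.
have -> : \int[Pi]_(f in measure_support Pi) L f = \int[Pi]_f L f.
  rewrite /Rintegral; congr fine.
  rewrite [RHS](@ge0_negligible_integral _ _ _ Pi setT (~` measure_support
    Pi))//.
  - by rewrite setTD setCK.
  - by apply: measurableC; exact: measurable_support.
  - exact/measurable_EFinP.
  - by move=> f _; rewrite lee_fin.
  - by apply: support_full; exact: H_hilbert.2.
set D := \int[Pi]_f L f.
have D0 : 0 <= D by apply: Rintegral_ge0 => f _.
have k0 : 0 < 1 - expR (- 1) :> R by rewrite subr_gt0 expR_lt1 oppr_lt0.
have Q0 : 0 <= Q by have := qQ 0; rewrite big_ord0.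
have key : (1 - expR (- 1)) * \int[Pi]_(f in B) L f <= Q / t ^+ 2 * D.
  pose M f := L f * (1 - expR (- (2 / t ^+ 2 / 2 * `|f - f0| ^+ 2))).
  have M0 f : 0 <= M f.
    rewrite mulr_ge0// subr_ge0 expR_le1 oppr_le0 mulr_ge0 ?sqr_ge0//.
    by rewrite divr_ge0// ltW.
  have ME : M = L \- (fun f => L f * expR (- (2 / t ^+ 2 / 2 * `|f -
    f0| ^+ 2))).
    by apply/funext => f; rewrite /M mulrBr mulr1.
  have iM : Pi.-integrable setT (EFin \o (M : borel H -> R)).
    rewrite (_ : _ \o _ = ((EFin \o (L : borel H -> R)) \- (EFin \o
      (fun f : borel H => (L f * expR (- (2 / t ^+ 2 / 2 * `|f -
        f0| ^+ 2)))%R)))%E).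
      exact: integrableB.
    by apply/funext => f; rewrite ME.
  have iLB : Pi.-integrable B (EFin \o (L : borel H -> R)).
    exact: integrableS iL.
  have iMB : Pi.-integrable B (EFin \o (M : borel H -> R)).
    exact: integrableS iM.
  rewrite -RintegralZl//.
  apply: (@le_trans _ _ (\int[Pi]_(f in B) M f)).
    apply: le_Rintegral => //.
      rewrite (_ : _ \o _ = (fun f => (1 - expR (- 1))%:E *
        (EFin \o (L : borel H -> R)) f)%E)//.
      exact: integrableZl.
    move=> f Bf; rewrite /M mulrC ler_wpM2l// lerB// ler_expR lerN2.
    have -> : 2 / t ^+ 2 / 2 * `|f - f0| ^+ 2 = (`|f - f0| / t) ^+ 2.
      by field; rewrite gt_eqF.
    rewrite exprn_ege1// ler_pdivlMr// mul1r ltW//.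
  apply: (@le_trans _ _ (\int[Pi]_f M f)).
    apply: fine_le; [exact: integrable_fin_num|exact: integrable_fin_num|].
    apply: ge0_subset_integral => //.
    - by have /integrableP[] := iM.
    - by move=> f _; rewrite lee_fin.
  have -> : \int[Pi]_f M f = D - \int[Pi]_f (L f * expR (- (2 / t ^+ 2 / 2 *
    `|f - f0| ^+ 2))).
    by rewrite ME RintegralB.
  apply: (@le_trans _ _ (D - expR (- (2 / t ^+ 2 / 2 * Q)) * D)).
    by rewrite lerB.
  rewrite -{1}[D]mul1r -mulrBl ler_wpM2r//.
  have -> : 2 / t ^+ 2 / 2 * Q = Q / t ^+ 2 by field; rewrite gt_eqF.
  by have := expR_ge1Dx (- (Q / t ^+ 2)); lra.
have [D00|Dn0] := eqVneq D 0.
  rewrite D00 invr0 mulr0; apply: mulr_ge0.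
    by rewrite invr_ge0 ltW.
  by rewrite divr_ge0// ltW.
have Dgt0 : 0 < D by rewrite lt_neqAle eq_sym Dn0.
by rewrite ler_pdivrMr// -mulrA mulrC ler_pdivlMr// mulrC.
Qed.

End ratio.
(** * Measurability of the posterior in the data *)

Section measurable_limit.
Context {R : realType} d (T : measurableType d).

(** A Cauchy criterion with countable quantifiers only, so that it defines a
    measurable set. *)
Lemma cvgn_cauchyP (u : nat -> R) : cvgn u <->
  forall k, exists N, forall m, `|u (N + m)%N - u N| <= k.+1%:R^-1.
Proof.
split.
  move=> cu k.
  have e0 : 0 < k.+1%:R^-1 / 2 :> R by rewrite divr_gt0// invr_gt0.
  have /cvgrPdist_le/(_ _ e0)[N _ NP] := cu.
  exists N => m; have := NP N (leqnn N); have := NP (N + m)%N (leq_addr m N).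
  rewrite /= => H1 H2.
  rewrite -(subrKA (limn u)) (le_trans (ler_normD _ _))// [leRHS]splitr lerD//.
  by rewrite distrC.
move=> H; apply: cauchy_cvg; apply: cauchy_exP => e e0.
have [k ke] : exists k, k.+1%:R^-1 < e.
  have [n _ /(_ n (leqnn n))] := near_infty_natSinv_lt (PosNum e0).
  by exists n.
have [N NP] := H k.
exists (u N); exists N => //= m Nm; rewrite /ball/= distrC.
by rewrite -(subnKC Nm) (le_lt_trans (NP _)).
Qed.

(** Where the sequence diverges limn is a default value, so measurability of
    the set of convergence is the point. *)
Lemma measurable_limn (h : nat -> T -> R) : (forall m, measurable_fun setT (h
  m)) ->
  measurable_fun setT (fun x => limn (h ^~ x)).
Proof.
move=> mh.
pose E := [set x | cvgn (h ^~ x)].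
have mE : measurable E.
  rewrite (_ : E = \bigcap_k \bigcup_N \bigcap_m
     [set x | `|h (N + m)%N x - h N x| <= k.+1%:R^-1]); last first.
    apply/seteqP; split => x.
      move=> /cvgn_cauchyP H k _; have [N NP] := H k.
      by exists N => // m _; exact: NP.
    move=> H; apply/cvgn_cauchyP => k; have [N _ NP] := H k I.
    by exists N => m; exact: NP.
  apply: bigcapT_measurable => k; apply: bigcupT_measurable => N.
  apply: bigcapT_measurable => m.
  have mf : measurable_fun setT (fun x => `|h (N + m)%N x - h N x|).
    by apply: measurableT_comp => //; exact: measurable_funB.
  have := mf measurableT `]-oo, k.+1%:R^-1]%classic (measurable_itv _).
  rewrite setTI; set S := (X in measurable X) => mS.
  have SE : S = [set x | `|h (N + m)%N x - h N x| <= k.+1%:R^-1].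
    by apply/seteqP; split => x; rewrite /S/= in_itv.
  by rewrite SE in mS; exact: mS.
rewrite -(setUv E); apply/measurable_funU => //; first exact: measurableC.
split.
  apply: (@measurable_fun_cvg _ _ _ _ h) => [m|x Ex].
    exact: measurable_funTS.
  exact: Ex.
apply: (@eq_measurable_fun _ _ _ _ _ (cst point)) => //.
by move=> x; rewrite inE /= => nE; rewrite dvgP.
Qed.

End measurable_limit.
(** The functions x / (x^2 + 1 / (m + 1)) are continuous and converge to the
    inverse everywhere, including at 0 where it is 0 by convention. *)
Lemma measurable_inv {R : realType} : measurable_fun setT (fun x : R => x^-1).
Proof.
apply: (measurable_fun_cvg (h := fun m (x : R) => x / (x ^+ 2 + m.+1%:R^-1))).
  move=> m; apply: continuous_measurable_fun => x.
  have m0 : x ^+ 2 + m.+1%:R^-1 != 0.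
    by rewrite gt_eqF// ltr_wpDl ?sqr_ge0// invr_gt0.
  apply: cvgM; first exact: cvg_id.
  apply: cvgV => //; apply: cvgD; last exact: cvg_cst.
  exact: exprn_continuous.
move=> x _.
have [->|x0] := eqVneq x 0.
  by under eq_fun do rewrite mul0r; rewrite invr0; exact: cvg_cst.
have -> : x^-1 = x / (x ^+ 2 + 0) by field.
apply: cvgM; first exact: cvg_cst.
apply: cvgV; first by rewrite addr0 sqrf_eq0.
by apply: cvgD; [exact: cvg_cst|exact: cvg_harmonic].
Qed.

Section measurable_posterior.
Context {R : realType} (H1 H2 : completeNormedModType R)
  (dot1 : {dot H1 for idfun}) (A : H1 -> H2) (e : nat -> H1) (rho : nat -> R)
  (Pi : probability (borel H1) R).
Hypothesis mcoord : forall k, measurable_fun setT (fun f : borel H1 => dot1 f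
  (e k)).
Hypothesis mA : measurable_fun setT (fun f : borel H1 => `|A f| ^+ 2).
Context d (T : measurableType d) (y : nat -> T -> R).
Hypothesis my : forall k, measurable_fun setT (y k).

Lemma measurable_likelihood n :
  measurable_fun setT (fun z : T * borel H1 =>
    likelihood dot1 A e rho n (fun k => y k z.1) z.2).
Proof.
apply: measurableT_comp => //; apply: measurable_funB; last first.
  by apply: measurable_funM => //; exact: (measurableT_comp mA measurable_snd).
apply: measurable_funM => //.
apply: (@measurable_limn _ _ _ (fun m (z : T * borel H1) =>
  [series rho k * dot1 z.2 (e k) * y k z.1]_k m)) => m.
apply: measurable_sum => k; apply: measurable_funM.
  by apply: measurable_funM => //; exact: (measurableT_comp (mcoord k)
    measurable_snd).
exact: (measurableT_comp (my k) measurable_fst).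
Qed.

(** Tonelli's theorem for the likelihood as a function of the pair (w, f). *)
Lemma measurable_integral_likelihood n (B : set H1) : measurable (B : set
  (borel H1)) ->
  measurable_fun setT (fun w =>
    \int[Pi]_(f in B) likelihood dot1 A e rho n (fun k => y k w) f).
Proof.
move=> mB.
pose g (z : T * borel H1) := (likelihood dot1 A e rho n (fun k => y k z.1) z.2
  * \1_B z.2)%:E.
have mg : measurable_fun setT g.
  apply/measurable_EFinP; apply: measurable_funM;
    first exact: measurable_likelihood.
  by apply: (measurableT_comp _ measurable_snd); exact: measurable_indic.
have g0 z : (0 <= g z)%E by rewrite lee_fin mulr_ge0// expR_ge0.
rewrite (_ : (fun w => _) = (fun w => fine (\int[Pi]_f g (w, f))%E)).
  apply: measurableT_comp => //.
  exact: (measurable_fun_fubini_tonelli_F (m2 := Pi) g).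
apply/funext => w; rewrite /Rintegral; congr fine.
rewrite [LHS]integral_mkcond; apply: eq_integral => f _.
by rewrite /g/= patchE indicE; case: ifPn => _; rewrite ?mulr1 ?mulr0.
Qed.

Lemma measurable_posterior n (B : set H1) : measurable (B : set (borel H1)) ->
  measurable_fun setT (fun w => posterior dot1 A e rho Pi n (fun k => y k w) B).
Proof.
move=> mB; apply: measurable_funM; first exact: measurable_integral_likelihood.
apply: measurableT_comp; first exact: measurable_inv.
by apply: measurable_integral_likelihood; exact: measurable_support.
Qed.

End measurable_posterior.
(** * The posterior error in one experiment *)

Section observation_moments.
Context {R : realType} d (T : measurableType d) (P : probability T R).

Lemma ge0_markov (Q : T -> \bar R) (a : R) : 0 < a ->
  measurable_fun setT Q -> (forall w, 0 <= Q w)%E ->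
  (P [set w | a%:E <= Q w] <= (a^-1)%:E * \int[P]_w Q w)%E.
Proof.
move=> a0 mQ Q0.
have := @le_integral_comp_abse _ _ _ P setT measurableT Q a (@id (\bar R)).
rewrite setTI => H.
rewrite lee_pdivlMl//.
have -> : [set w | a%:E <= Q w]%E = [set w | a%:E <= `|Q w|]%E.
  by apply/seteqP; split => w /=; rewrite gee0_abs.
apply: le_trans (H _ _ _ _ _) _ => //.
by under eq_integral do rewrite gee0_abs//.
Qed.

Variables (Z : nat -> T -> R).
Hypothesis mZ : forall k, measurable_fun setT (Z k).
Hypothesis Z2 : forall k, (\int[P]_w (Z k w ^+ 2)%:E = 1)%E.
Variables (rho a v : nat -> R).

Lemma integral_affine_sqr (al be : R) k : 0 <= al -> 0 <= be ->
  (\int[P]_w (al + be * Z k w ^+ 2)%:E = (al + be)%:E)%E.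
Proof.
move=> al0 be0.
have mZ2 : measurable_fun setT (fun w => (Z k w ^+ 2)%:E).
  by apply/measurable_EFinP; exact: measurable_funX.
under eq_integral do rewrite EFinD EFinM.
rewrite ge0_integralD//.
- rewrite integral_cst// [X in (_ * X)%E](probability_setT P) mule1.
  by rewrite ge0_integralZl// ?Z2 ?mule1// => w _; rewrite lee_fin sqr_ge0.
- by move=> w _; rewrite -EFinM lee_fin mulr_ge0// sqr_ge0.
- by apply: emeasurable_funM.
Qed.

Hypothesis v_gt0 : forall k, 0 < v k.
Variables (n : nat).
Hypothesis n_gt0 : (0 < n)%N.
Let y k w := rho k * a k + (Num.sqrt n%:R)^-1 * Z k w.
Let b k w := n%:R * rho k * y k w.
Let x k := n%:R * rho k ^+ 2 * v k.

Let n0 : 0 < n%:R :> R. Proof. by rewrite ltr0n. Qed.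
Let x0 k : 0 <= x k.
Proof. by rewrite mulr_ge0 ?(ltW (v_gt0 k))// mulr_ge0 ?sqr_ge0// ltW. Qed.
Let x1 k : 0 < 1 + x k.
Proof. by rewrite ltr_wpDr. Qed.

(** The data enter the squared bias through the noise; splitting the square
    by (p - q)^2 <= 2 p^2 + 2 q^2 leaves only the second moment of Z to be
    known. *)
Lemma posterior_error_le k w :
  v k / (1 + x k) + (b k w * v k / (1 + x k) - a k) ^+ 2 <=
  (v k + 2 * a k ^+ 2) / (1 + x k) + 2 * v k / (1 + x k) * Z k w ^+ 2.
Proof.
pose s : R := Num.sqrt n%:R.
have s0 : 0 < s by rewrite sqrtr_gt0.
have sn : s ^+ 2 = n%:R by rewrite sqr_sqrtr// ltW.
have xs : x k = s ^+ 2 * rho k ^+ 2 * v k by rewrite sn.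
have -> : b k w * v k / (1 + x k) - a k = (s * rho k * v k * Z k w -
  a k) / (1 + x k).
  rewrite /b /y -/s -sn xs; field.
  by rewrite exprMn -xs (gt_eqF s0) gt_eqF.
have h : (s * rho k * v k * Z k w - a k) ^+ 2 <=
  2 * a k ^+ 2 + 2 * x k * v k * Z k w ^+ 2.
  rewrite xs; set p := s * rho k * v k * Z k w.
  have -> : 2 * (s ^+ 2 * rho k ^+ 2 * v k) * v k * Z k w ^+ 2 =
    2 * p ^+ 2 by rewrite /p; ring.
  by have := sqr_ge0 (p + a k); rewrite !expr2; nra.
rewrite expr_div_n.
have -> : (v k + 2 * a k ^+ 2) / (1 + x k) + 2 * v k / (1 + x k) * Z k w ^+ 2 =
  v k / (1 + x k) + (2 * a k ^+ 2 * (1 + x k) + 2 * (1 + x k) * v k *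
    Z k w ^+ 2) / (1 + x k) ^+ 2.
  by field; rewrite gt_eqF.
rewrite lerD2l ler_wpM2r ?invr_ge0 ?sqr_ge0//.
apply: le_trans h _; apply: lerD.
  apply: ler_peMr; [by rewrite mulr_ge0// sqr_ge0|by rewrite lerDl].
rewrite ler_wpM2r ?sqr_ge0// ler_wpM2r ?(ltW (v_gt0 k))// ler_wpM2l//.
by rewrite lerDr.
Qed.

Let Q w := (\sum_(0 <= k <oo) ((v k + 2 * a k ^+ 2) / (1 + x k) + 2 *
  v k / (1 + x k) * Z k w ^+ 2)%:E)%E.
Let S w := (\sum_(0 <= k <oo) (`|b k w| * Num.sqrt (v k))%:E)%E.

Let q0 k w : 0 <= (v k + 2 * a k ^+ 2) / (1 + x k) + 2 * v k / (1 + x k) *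
  Z k w ^+ 2.
Proof.
have v0 := ltW (v_gt0 k); have x0' := ltW (x1 k).
apply: addr_ge0; first by rewrite divr_ge0// addr_ge0// mulr_ge0// sqr_ge0.
by rewrite mulr_ge0 ?sqr_ge0// divr_ge0// mulr_ge0.
Qed.

Lemma measurable_error_series : measurable_fun setT Q.
Proof.
apply: ge0_emeasurable_sum => [k w _ _|k _]; first by rewrite lee_fin.
apply/measurable_EFinP; apply: measurable_funD => //.
by apply: measurable_funM => //; exact: measurable_funX.
Qed.

Lemma integral_error_series : (\int[P]_w Q w =
  \sum_(0 <= k <oo) ((3 * v k + 2 * a k ^+ 2) / (1 + x k))%:E)%E.
Proof.
rewrite integral_nneseries//; last 2 first.
- move=> k; apply/measurable_EFinP; apply: measurable_funD => //.
  by apply: measurable_funM => //; exact: measurable_funX.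
- by move=> k w _; rewrite lee_fin.
apply: eq_eseriesr => k _; rewrite integral_affine_sqr.
- by congr EFin; rewrite -mulrDl; congr (_ / _); ring.
- apply: divr_ge0 (ltW (x1 k)); apply: addr_ge0; first exact: ltW.
  by rewrite mulr_ge0// sqr_ge0.
- by apply: divr_ge0 (ltW (x1 k)); rewrite mulr_ge0// ltW.
Qed.

(** The mean of the series is finite: the variables Y_k have bounded second
    moments and the rho_k are summable. *)
Lemma ae_summable_linear_term (M : R) :
  (forall k, v k <= 1) -> (forall k, (rho k * a k) ^+ 2 <= M) ->
  (\sum_(0 <= k <oo) (`|rho k|)%:E < +oo)%E ->
  measurable_fun setT S /\ P [set w | S w = +oo%E] = 0%E.
Proof.
move=> v1 aM rhoS.
have mb k : measurable_fun setT (fun w => (`|b k w| * Num.sqrt (v k))%:E).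
  apply/measurable_EFinP; apply: measurable_funM => //;
    apply: measurableT_comp => //.
  apply: measurable_funM => //; apply: measurable_funD => //.
  exact: measurable_funM.
have bs0 k w : (0 <= (`|b k w| * Num.sqrt (v k))%:E)%E.
  by rewrite lee_fin mulr_ge0// sqrtr_ge0.
have mS : measurable_fun setT S by apply: ge0_emeasurable_sum.
split => //.
have S0 w : (0 <= S w)%E by apply: nneseries_ge0.
have M0 : 0 <= M by apply: le_trans (aM 0); exact: sqr_ge0.
have IS : (\int[P]_w S w < +oo)%E.
  rewrite integral_nneseries//.
  apply: (@le_lt_trans _ _ (\sum_(0 <= k <oo) ((n%:R * (1 + 2 * M + 2 *
    n%:R^-1))%:E * (`|rho k|)%:E))%E).
    apply: lee_nneseries => [k _ _|k _]; first exact: integral_ge0.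
    apply: (@le_trans _ _ (\int[P]_w ((n%:R * `|rho k| * (1 + 2 * M) + n%:R *
      `|rho k| * (2 * n%:R^-1) * Z k w ^+ 2)%:E))%E).
      apply: ge0_le_integral => //.
        apply/measurable_EFinP; apply: measurable_funD => //.
        by apply: measurable_funM => //; exact: measurable_funX.
      move=> w _; rewrite lee_fin.
      have sv : Num.sqrt (v k) <= 1 by rewrite -sqrtr1 ler_sqrt.
      apply: (@le_trans _ _ `|b k w|); first by rewrite ler_piMr.
      rewrite /b normrM normrM (ger0_norm (ltW n0)) -!mulrA -mulrDr ler_wpM2l
        ?(ltW n0)//.
      rewrite -mulrDr ler_wpM2l//.
      have yle : y k w ^+ 2 <= 2 * M + 2 * (n%:R^-1 * Z k w ^+ 2).
        have -> : n%:R^-1 * Z k w ^+ 2 = ((Num.sqrt n%:R)^-1 * Z k w) ^+ 2 :> R.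
          by rewrite exprMn exprVn sqr_sqrtr// ltW.
        have := aM k; rewrite /y; set p := rho k * a k; set r := _^-1 * _.
        by have := sqr_ge0 (p - r); rewrite !expr2; nra.
      have := sqr_ge0 (`|y k w| - 1); have := normr_ge0 (y k w).
      have := real_normK (num_real (y k w)); rewrite !expr2 in yle *; nra.
    rewrite integral_affine_sqr ?mulr_ge0 ?invr_ge0 ?addr_ge0 ?mulr_ge0 ?(ltW
      n0)//.
    by rewrite -EFinM lee_fin le_eqVlt; apply/orP; left; apply/eqP; ring.
  rewrite nneseriesZl; last by move=> k _; rewrite lee_fin.
  rewrite lte_mul_pinfty ?lee_fin ?mulr_ge0 ?addr_ge0 ?mulr_ge0 ?invr_ge0 ?(ltW
    n0)//.
have iS : P.-integrable setT S.
  apply/integrableP; split => //.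
  by under eq_integral do rewrite gee0_abs//.
have [N [mN N0 NS]] := integrable_ae measurableT iS.
apply/eqP; rewrite -measure_le0 -N0 le_measure ?inE//.
  rewrite -[X in measurable X]setTI.
  exact: (mS measurableT [set +oo%E] (emeasurable_set1 _)).
by move=> w /= Sw; apply: NS => /= /(_ I); rewrite Sw.
Qed.

End observation_moments.

Section single_experiment.
Context {R : realType} (H1 H2 : completeNormedModType R)
  (dot1 : {dot H1 for idfun}) (dot2 : {dot H2 for idfun}).
Hypotheses (H1_hilbert : separable_hilbert dot1) (H2_hilbert :
  separable_hilbert dot2).
Variables (A : {linear H1 -> H2}) (Astar : H2 -> H1).
Hypotheses (A_cont : continuous A) (A_inj : injective A)
  (A_adj : is_adjoint dot1 dot2 A Astar).
Variables (e : nat -> H1) (g : nat -> H2) (rho : nat -> R).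
Hypotheses (e_basis : orthonormal_basis dot1 e)
  (e_eigen : forall k, Astar (A (e k)) = rho k ^+ 2 *: e k)
  (g_conj : forall k, A (e k) = rho k *: g k).

Lemma singular_value_neq0 k : rho k != 0.
Proof.
have [e_orth _] := e_basis.
apply/eqP => rk0.
have e0 : e k = 0 by apply: A_inj; rewrite g_conj rk0 scale0r linear0.
by have := e_orth k k; rewrite e0 dot0l eqxx => /eqP; rewrite eq_sym oner_eq0.
Qed.

Lemma dot_image_basis j k : dot2 (A (e j)) (A (e k)) = (j == k)%:R * rho k ^+ 2.
Proof. by have [e_orth _] := e_basis; rewrite A_adj e_eigen dotZr e_orth mulrC.
  Qed.

(** This is where the observations become the coordinates
    Y_k = rho_k f0_k + Z_k / sqrt n. *)
Lemma dot_image_conjugate f k : dot2 (A f) (g k) = rho k * dot1 f (e k).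
Proof.
have rk := singular_value_neq0 k.
have := A_adj f (A (e k)).
rewrite e_eigen g_conj !dotZr => h.
by apply: (mulfI rk); rewrite h; ring.
Qed.

Lemma conjugate_unit k : dot2 (g k) (g k) = 1.
Proof.
have rk := singular_value_neq0 k.
have := dot_image_basis k k; rewrite g_conj dotZl dotZr eqxx mul1r expr2 mulrA.
rewrite -[in RHS](mulr1 (rho k * rho k)).
by apply: mulfI; rewrite mulf_neq0.
Qed.

Lemma cvg_image_norm (f : H1) :
  [series rho k ^+ 2 * dot1 f (e k) ^+ 2]_k @ \oo --> `|A f| ^+ 2.
Proof.
have := @cvg_sqr_norm R H1 H2 dot1 dot2 H2_hilbert.1 e e_basis A (fun k => rho
  k ^+ 2) A_cont dot_image_basis f.
rewrite (_ : [series _]_k = [series rho k ^+ 2 * dot1 f (e k) ^+ 2]_k)//.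
by apply/funext => m; rewrite /series/=; apply: eq_bigr => k _; rewrite mulrC.
Qed.

Lemma image_coordinate_le (f : H1) k : (rho k * dot1 f (e k)) ^+ 2 <=
  `|A f| ^+ 2.
Proof.
have cv := @cvg_image_norm f.
have nd : nondecreasing_seq [series rho k ^+ 2 * dot1 f (e k) ^+ 2]_k.
  by apply: nondecreasing_series => j _ _; rewrite mulr_ge0// sqr_ge0.
have := nondecreasing_cvgn_le nd (cvgP _ cv) k.+1.
rewrite (cvg_lim _ cv)//; apply: le_trans.
rewrite /series/= big_mkord big_ord_recr/= -exprMn lerDr.
by apply: sumr_ge0 => j _; rewrite mulr_ge0// sqr_ge0.
Qed.

Variables (Lambda : {linear H1 -> H1}) (v : nat -> R).
Variable (Pi : probability (borel H1) R).
Hypothesis v_gt0 : forall k, 0 < v k.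
Hypothesis v_le1 : forall k, v k <= 1.
Hypothesis Lambda_e : forall k, Lambda (e k) = v k *: e k.
Hypothesis Pi_gaussian : gaussian_measure dot1 Lambda Pi.
Hypothesis rho_sum : (\sum_(0 <= k <oo) (`|rho k|)%:E < +oo)%E.
Variable f0 : H1.

(** Off the null event where the linear term diverges, a large posterior mass
    forces the error series to be large, and Markov's inequality applies. *)
Lemma posterior_tail_prob d (T : measurableType d) (P : probability T R)
    (Z : H2 -> T -> R) (n : nat) (t eps : R) :
  (0 < n)%N -> white_noise dot2 P Z -> 0 < t -> 0 < eps ->
  (P [set w | (eps < `|posterior dot1 A e rho Pi n
       (fun k => observation dot2 A f0 n Z (g k) w) [set f | `|f - f0| > t]|)%R]
   <= ((1 - expR (- 1))^-1 / (t ^+ 2 * eps))%:E *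
      \sum_(0 <= k <oo) ((3 * v k + 2 * dot1 f0 (e k) ^+ 2) /
          (1 + n%:R * rho k ^+ 2 * v k))%:E)%E.
Proof.
move=> n_gt0 [ZG ZE ZC] t0 eps0.
have n0 : 0 < n%:R :> R by rewrite ltr0n.
pose Zk k := Z (g k).
pose a k := dot1 f0 (e k).
have mZ k : measurable_fun setT (Zk k).
  have [+ _] := ZG 1%N (fun=> 1) (fun=> g k).
  by rewrite (_ : (fun w => _) = Zk k)//; apply/funext => w;
    rewrite big_ord1 mul1r.
have Z2 k : (\int[P]_w (Zk k w ^+ 2)%:E = 1)%E.
  by rewrite -covariance_centered ?ZE// ZC conjugate_unit.
pose y k w := rho k * a k + (Num.sqrt n%:R)^-1 * Zk k w.
have yE w : (fun k => observation dot2 A f0 n Z (g k) w) = y^~ w.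
  by apply/funext => k; rewrite /observation dot_image_conjugate.
have my k : measurable_fun setT (y k).
  by apply: measurable_funD => //; exact: measurable_funM.
have mc k : measurable_fun setT (fun f : borel H1 => dot1 f (e k)).
  exact: (measurable_coordinate Pi_gaussian).
have mA : measurable_fun setT (fun f : borel H1 => `|A f| ^+ 2).
  apply: (measurable_fun_cvg (h := fun m (f : borel H1) => [series rho k ^+ 2 *
    dot1 f (e k) ^+ 2]_k m)).
    move=> m; apply: measurable_sum => k; apply: measurable_funM => //.
    exact: measurable_funX.
  by move=> f _; exact: cvg_image_norm.
pose B := [set f : H1 | `|f - f0| > t].
have mB : measurable (B : set (borel H1)).
  by apply: (measurable_far H1_hilbert e_basis Pi_gaussian); exact: ltW.
pose post w := posterior dot1 A e rho Pi n (y^~ w) B.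
have -> : [set w | eps < `|posterior dot1 A e rho Pi n
   (fun k => observation dot2 A f0 n Z (g k) w) B|] = [set w | eps < `|post w|].
  by apply/seteqP; split => w /=; rewrite yE.
have mpost : measurable_fun setT post by exact: measurable_posterior.
pose b k w := n%:R * rho k * y k w.
pose x k := n%:R * rho k ^+ 2 * v k.
pose Q w := (\sum_(0 <= k <oo) ((v k + 2 * a k ^+ 2) / (1 + x k) + 2 *
  v k / (1 + x k) * Zk k w ^+ 2)%:E)%E.
pose S w := (\sum_(0 <= k <oo) (`|b k w| * Num.sqrt (v k))%:E)%E.
have mQ : measurable_fun setT Q.
  exact: (measurable_error_series mZ rho a v_gt0 n).
have EQ := integral_error_series mZ Z2 rho a v_gt0 n.
have [mS S0] := ae_summable_linear_term mZ Z2 n_gt0 v_le1 (image_coordinate_le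
  f0) rho_sum.
have err k w := posterior_error_le Zk rho a v_gt0 n_gt0 k w.
pose K : R := (1 - expR (- 1))^-1.
have K0 : 0 < K by rewrite invr_gt0 subr_gt0 expR_lt1 oppr_lt0.
(* the level of the error series below which the posterior mass is at most eps *)
pose lev := t ^+ 2 * eps / K.
have lev0 : 0 < lev by rewrite divr_gt0// mulr_gt0// exprn_gt0.
have q0 k w : 0 <= (v k + 2 * a k ^+ 2) / (1 + x k) + 2 * v k / (1 + x k) *
  Zk k w ^+ 2.
  apply: le_trans (err k w).
  rewrite addr_ge0 ?sqr_ge0// divr_ge0 ?(ltW (v_gt0 k))// addr_ge0// mulr_ge0
    ?(ltW (v_gt0 k))//.
  by rewrite mulr_ge0 ?sqr_ge0// ltW.
have Q0 w : (0 <= Q w)%E by apply: nneseries_ge0 => k _ _; rewrite lee_fin.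
have sub : [set w | eps < `|post w|] `<=` [set w | lev%:E <=
  Q w]%E `|` [set w | S w = +oo%E].
  move=> w /= pw.
  have [Soo|Sfin] := eqVneq (S w) +oo%E; [by right|left].
  have [Qoo|Qfin] := eqVneq (Q w) +oo%E; first by rewrite Qoo leey.
  have Qf : Q w \is a fin_num by rewrite ge0_fin_numE// lt_neqAle Qfin leey.
  have Qs m : \sum_(k < m) (v k / (1 + x k) + (b k w * v k / (1 + x k) -
    a k) ^+ 2) <= fine (Q w).
    apply: (@le_trans _ _ (\sum_(k < m) ((v k + 2 * a k ^+ 2) / (1 + x k) + 2 *
      v k / (1 + x k) * Zk k w ^+ 2))).
      by apply: ler_sum => k _; exact: err.
    rewrite -lee_fin fineK// -sumEFin -(big_mkord xpredT (fun k => ((v k + 2 *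
      a k ^+ 2) / (1 + x k) + 2 * v k / (1 + x k) * Zk k w ^+ 2)%:E)).
    by apply: nneseries_lim_ge => k _ _; rewrite lee_fin.
  have c0 k : 0 < n%:R * rho k ^+ 2.
    by rewrite mulr_gt0// exprn_even_gt0//= singular_value_neq0.
  have mL : measurable_fun setT (fun f : borel H1 => likelihood dot1 A e rho n
    (y^~ w) f).
    exact: measurableT_comp (measurable_likelihood rho mc mA my n)
      (pair1_measurable w).
  have := @posterior_ratio R H1 dot1 H1_hilbert e Lambda v Pi e_basis v_gt0
    Lambda_e Pi_gaussian
    (b^~ w) (fun k => n%:R * rho k ^+ 2) (fun f => likelihood dot1 A e rho n
      (y^~ w) f)
    (fun f => n%:R * `|A f| ^+ 2) c0 _ mL _ _ _ f0 t (fine (Q w)) t0 Qs.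
  move=> H.
  have pQ : post w <= K * (fine (Q w) / t ^+ 2).
    apply: H.
    - by rewrite ltey.
    - by move=> f; exact: expR_ge0.
    - move=> f.
      rewrite (_ : [series _]_k = (fun m => n%:R * [series rho k ^+ 2 *
        dot1 f (e k) ^+ 2]_k m)).
        by apply: cvgM; [exact: cvg_cst|exact: cvg_image_norm].
      apply/funext => m; rewrite /series/= mulr_sumr; apply: eq_bigr => k _.
      by ring.
    - move=> f cf.
      have bE : [series b k w * dot1 f (e k)]_k =
          (fun m => n%:R * [series rho k * dot1 f (e k) * y k w]_k m).
        apply/funext => m; rewrite /series/= mulr_sumr; apply: eq_bigr => k _.
        by rewrite /b; ring.
      have cy : cvgn [series rho k * dot1 f (e k) * y k w]_k.
        rewrite (_ : [series _]_k = (fun m => n%:R^-1 * [series b k w *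
          dot1 f (e k)]_k m)).
          by apply: is_cvgM; [exact: is_cvg_cst|exact: cf].
        by apply/funext => m; rewrite bE mulrA mulVf ?mul1r// gt_eqF.
      rewrite /likelihood; congr expR; congr (_ - _); last by rewrite mulrAC.
      apply/esym; rewrite bE; apply: cvg_lim => //.
      by apply: cvgM; [exact: cvg_cst|exact: cy].
  have post0 : 0 <= post w.
    by apply: divr_ge0; apply: Rintegral_ge0 => f _; exact: expR_ge0.
  rewrite ger0_norm// in pw.
  have h : eps <= K * (fine (Q w) / t ^+ 2) by rewrite ltW// (lt_le_trans pw).
  rewrite mulrA ler_pdivlMr ?exprn_gt0// in h.
  by rewrite -[Q w]fineK// lee_fin /lev ler_pdivrMr// mulrC [leRHS]mulrC.
have mE : measurable [set w | eps < `|post w|].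
  have mf : measurable_fun setT (fun w => `|post w|) by exact: measurableT_comp.
  have := mf measurableT `]eps, +oo[%classic (measurable_itv _).
  rewrite setTI; set U := (X in measurable X) => mU.
  have UE : U = [set w | eps < `|post w|].
    by apply/seteqP; split => w; rewrite /U/= in_itv/= andbT.
  by rewrite UE in mU.
have mQl : measurable [set w | lev%:E <= Q w]%E.
  by rewrite -[X in measurable X]setTI; exact: emeasurable_fun_c_infty.
have mSo : measurable [set w | S w = +oo%E].
  rewrite -[X in measurable X]setTI.
  exact: (mS measurableT [set +oo%E] (emeasurable_set1 _)).
apply: (@le_trans _ _ (P ([set w | lev%:E <= Q w]%E `|` [set w | S w =
  +oo%E]))).
  by rewrite le_measure ?inE//; exact: measurableU.
apply: (le_trans (measureU2 _ mQl mSo)).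
rewrite [X in (_ + X)%E]S0 adde0.
apply: (le_trans (ge0_markov P lev0 mQ Q0)).
by rewrite EQ /lev invf_div.
Qed.

End single_experiment.
(** * The rate *)

Section growth.
Context {R : realType}.

Lemma powR_expE (x p : R) : 0 < x -> x `^ p = expR (p * ln x).
Proof. by move=> x0; rewrite /powR gt_eqF. Qed.

(** With u = x^s and N at least p / s, this is (c u / N)^N <= exp(c u). *)
Lemma powR_le_expR (p s c : R) : 0 < s -> 0 < c ->
  exists2 M, 0 < M & forall x, 1 <= x -> x `^ p <= M * expR (c * x `^ s).
Proof.
move=> s0 c0; pose N := (Num.truncn `|p / s|).+1.
have N0 : 0 < N%:R :> R by rewrite ltr0n.
have Np : p / s <= N%:R by rewrite (le_trans (ler_norm _))// ltW// truncnS_gt.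
exists ((N%:R / c) ^+ N); first by rewrite exprn_gt0// divr_gt0.
move=> x x1; have x0 : 0 < x by lra.
set u := x `^ s.
have u0 : 0 < u by exact: powR_gt0.
apply: (@le_trans _ _ (u ^+ N)).
  rewrite -powR_mulrn ?(ltW u0)// -powRrM; apply: (ler_powR x1).
  by rewrite mulrC -ler_pdivrMr.
have -> : u ^+ N = (N%:R / c) ^+ N * (c * u / N%:R) ^+ N.
  by rewrite -exprMn; congr (_ ^+ _); field; rewrite !gt_eqF.
apply: ler_wpM2l; first by rewrite exprn_ge0// divr_ge0// ltW.
have -> : expR (c * u) = expR (c * u / N%:R) ^+ N.
  by rewrite -expRM_natl; congr expR; field; rewrite gt_eqF.
have q0 : 0 <= c * u / N%:R by apply: divr_ge0 => //; rewrite mulr_ge0// ltW.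
rewrite ler_pXn2r ?nnegrE ?expR_ge0//.
by apply: le_trans (expR_ge1Dx _); rewrite lerDr.
Qed.

(** The difference is s times a lower bound of the increment of -x^(-s), by
    log(1 + 1/x) >= 1 / (x + 1); summing gives the convergence of the series
    of (k + 1)^(-(1 + s)). *)
Lemma powR_telescope (s x : R) : 0 < s -> 1 <= x ->
  (x + 1) `^ (- (1 + s)) <= s^-1 * (x `^ (- s) - (x + 1) `^ (- s)).
Proof.
move=> s0 x1; have x0 : 0 < x by lra.
have y0 : 0 < x + 1 by lra.
rewrite ler_pdivlMl// lerBrDl.
have -> : - (1 + s) = - s - 1 by ring.
have nz : (- s == 1) ==> (x + 1 != 0) by rewrite (gt_eqF y0) implybT.
rewrite (powRB nz) powRr1 ?(ltW y0)//.
have h : (x + 1)^-1 <= ln (x + 1) - ln x.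
  have -> : ln (x + 1) - ln x = - ln (x / (x + 1)).
    by rewrite ln_div ?posrE// opprB.
  have := @le_ln1Dx R (- (x + 1)^-1).
  have -> : 1 + - (x + 1)^-1 = x / (x + 1) by field; rewrite gt_eqF.
  by rewrite ltrN2 invf_lt1// ltrDr x0 => /(_ isT); lra.
rewrite !powR_expE//.
have -> : - s * ln x = - s * ln (x + 1) + s * (ln (x + 1) - ln x) by ring.
rewrite expRD.
have : 1 + s * (x + 1)^-1 <= expR (s * (ln (x + 1) - ln x)).
  apply: le_trans (expR_ge1Dx _); rewrite lerD2l ler_wpM2l// ltW//.
have := expR_gt0 (- s * ln (x + 1)).
set E := expR _; set F := expR _; set z := _^-1 => E0 h2.
have -> : E + s * (E / (x + 1)) = E * (1 + s * z) by rewrite /z; ring.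
by rewrite ler_wpM2l// ltW.
Qed.

Lemma summable_powR (s : R) : 0 < s ->
  (\sum_(0 <= k <oo) ((k.+1%:R : R) `^ (- (1 + s)))%:E < +oo)%E.
Proof.
move=> s0.
have part m : \sum_(0 <= k < m.+1) (k.+1%:R : R) `^ (- (1 + s)) <=
  1 + s^-1 * (1 - m.+1%:R `^ (- s)).
  elim: m => [|m IH].
    by rewrite big_nat1 powR1 subrr mulr0 addr0.
  rewrite big_nat_recr//=.
  have := @powR_telescope s m.+1%:R s0; rewrite ler1n => /(_ isT).
  rewrite -natr1 in IH *; rewrite -[m.+2%:R]natr1 -[m.+1%:R]natr1 in IH *.
  lra.
apply: (@le_lt_trans _ _ (1 + s^-1)%:E); last exact: ltry.
apply: lime_le.
  by apply: is_cvg_nneseries => k _ _; rewrite lee_fin powR_ge0.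
apply: nearW => m; rewrite sumEFin lee_fin.
case: m => [|m]; first by rewrite big_geq// addr_ge0// invr_ge0 ltW.
apply: le_trans (part m) _; by rewrite lerD2l ler_piMr ?invr_ge0 ?(ltW s0)//
  gerBl powR_ge0.
Qed.

End growth.
Section rates.
Context {R : realType}.
Notation W := (@weight R).

Lemma weight_ge1 k : 1 <= W k.
Proof. by rewrite /weight lerDl sqr_ge0. Qed.

Lemma weight_gt0 k : 0 < W k.
Proof. exact: lt_le_trans (weight_ge1 k). Qed.

Lemma sqr_le_weight k : k.+1%:R ^+ 2 <= W k.
Proof. by rewrite /weight lerDr. Qed.

Lemma weight_le_sqr k : W k <= 2 * k.+1%:R ^+ 2.
Proof.
rewrite /weight mulr_natl mulr2n lerD2r.
by rewrite exprn_ege1// ler1n.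
Qed.

Lemma summable_weight (p : R) : 1 / 2 < p ->
  (\sum_(0 <= k <oo) (W k `^ (- p))%:E < +oo)%E.
Proof.
move=> p1; have s0 : 0 < 2 * p - 1 by lra.
apply: le_lt_trans (summable_powR s0).
apply: lee_nneseries => [k _ _|k _]; first by rewrite lee_fin powR_ge0.
rewrite lee_fin !powRN lef_pV2 ?posrE ?powR_gt0 ?weight_gt0 ?ltr0n//.
have -> : 1 + (2 * p - 1) = 2 * p by ring.
rewrite powRrM powR_mulrn//.
by apply: ge0_ler_powR; rewrite ?nnegrE ?sqr_ge0 ?(ltW (weight_gt0 k))
  ?sqr_le_weight//; lra.
Qed.

(** Finitely many indices are absorbed by the constant. *)
Lemma bounded_ratio (u w : nat -> R) (M : R) : (forall k, 0 < w k) -> 0 <= M ->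
  (\forall k \near \oo, u k <= M * w k) ->
  exists2 M', 0 < M' & forall k, u k <= M' * w k.
Proof.
move=> w0 M0 [N _ NP].
have r0 k : 0 <= `|u k| / w k by rewrite divr_ge0// ltW.
exists (1 + M + \sum_(k < N) `|u k| / w k).
  by rewrite ltr_wpDr ?sumr_ge0// ltr_wpDr.
move=> k; have [kN|Nk] := ltnP k N.
  apply: (@le_trans _ _ ((`|u k| / w k) * w k)).
    by rewrite divfK ?gt_eqF// ler_norm.
  rewrite ler_wpM2r ?(ltW (w0 k))// (bigD1 (Ordinal kN))//= addrCA lerDl.
  by rewrite addr_ge0 ?sumr_ge0// addr_ge0.
apply: le_trans (NP k Nk) _; rewrite ler_wpM2r ?(ltW (w0 k))//.
by rewrite -addrA addrCA lerDl addr_ge0// sumr_ge0.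
Qed.

Variables (rho : nat -> R) (beta : R).
Hypothesis rho_severe : severely_ill_posed rho beta.

Lemma beta_gt0 : 0 < beta.
Proof. by have [C1 [C2 [c0 [a0 [a1 []]]]]] := rho_severe. Qed.

(** The exponential factor beats every power of the weight, in particular the
    one missing for a summable bound 1 / weight. *)
Lemma severe_upper : (\sum_(0 <= k <oo) (`|rho k|)%:E < +oo)%E.
Proof.
have [C1 [C2 [c0 [a0 [a1 [C10 C20 c00 b0 nr]]]]]] := rho_severe.
have b20 : 0 < beta / 2 by rewrite divr_gt0.
(* the power of 2 comes from W_k <= 2 (k+1)^2 *)
pose c2 := c0 * 2 `^ (- (beta / 2)).
have c20 : 0 < c2 by rewrite mulr_gt0// powR_gt0.
have [M M0 MP] := powR_le_expR (1 - a1 / 2) b20 c20.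
have [M' M'0 M'P] : exists2 M', 0 < M' & forall k, `|rho k| <=
  M' * W k `^ (- 1).
  apply: (@bounded_ratio _ _ (C2 * M)).
  - by move=> k; rewrite powR_gt0// weight_gt0.
  - by rewrite mulr_ge0// ltW.
  apply: filterS nr => k [_ up]; apply: le_trans up _.
  have wk := weight_gt0 k.
  rewrite -!mulrA ler_wpM2l ?(ltW C20)//.
  have -> : W k `^ (- a1 / 2) = W k `^ (1 - a1 / 2) * W k `^ (- 1).
    rewrite -powRD; last by rewrite (gt_eqF wk) implybT.
    by congr powR; ring.
  rewrite mulrAC ler_wpM2r ?powR_ge0//.
  rewrite mulNr expRN ler_pdivrMr ?expR_gt0//.
  apply: le_trans (MP _ (weight_ge1 k)) _; rewrite ler_wpM2l ?(ltW M0)//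
    ler_expR.
  rewrite /c2 -mulrA ler_wpM2l ?(ltW c00)//.
  rewrite powRN mulrC ler_pdivrMr ?powR_gt0//.
  have -> : k.+1%:R `^ beta = (k.+1%:R ^+ 2) `^ (beta / 2) :> R.
    by rewrite -powR_mulrn// -powRrM; congr powR; field.
  rewrite -powRM ?sqr_ge0//.
  apply: ge0_ler_powR; rewrite ?(ltW b20) ?nnegrE ?(ltW wk) ?mulr_ge0
    ?sqr_ge0//.
  by rewrite mulrC weight_le_sqr.
apply: (@le_lt_trans _ _ (\sum_(0 <= k <oo) (M'%:E * (W k `^ (- 1))%:E))%E).
  by apply: lee_nneseries => // k _; rewrite -EFinM lee_fin.
rewrite nneseriesZl; last by move=> k _; rewrite lee_fin powR_ge0.
rewrite lte_mul_pinfty ?lee_fin ?(ltW M'0)//.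
by apply: summable_weight; lra.
Qed.

(** The powers of the weight are absorbed by enlarging the constant in the
    exponential. *)
Lemma severe_lower (q : R) : (forall k, rho k != 0) ->
  exists c c1 : R, [/\ 0 < c, 0 < c1 &
    forall k, c * expR (- (c1 * W k `^ (beta / 2))) <= rho k ^+ 2 * W k `^ q].
Proof.
move=> rho0.
have [C1 [C2 [c0 [a0 [a1 [C10 C20 c00 b0 nr]]]]]] := rho_severe.
have b20 : 0 < beta / 2 by rewrite divr_gt0.
have [M M0 MP] := powR_le_expR (a0 - q) b20 (@ltr01 R).
(* 2 c0 from squaring rho_k, 1 to absorb the powers of W_k *)
pose c1 := 1 + 2 * c0.
have r0 k : 0 < rho k ^+ 2 * W k `^ q.
  by rewrite mulr_gt0 ?powR_gt0 ?weight_gt0// exprn_even_gt0//= rho0.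
have [M' M'0 M'P] : exists2 M', 0 < M' & forall k,
    expR (- (c1 * W k `^ (beta / 2))) <= M' * (rho k ^+ 2 * W k `^ q).
  apply: (@bounded_ratio _ _ (M / C1 ^+ 2)) => //.
    by rewrite divr_ge0 ?sqr_ge0// ltW.
  apply: filterS nr => k [low _].
  have wk := weight_gt0 k.
  have low2 : (C1 * W k `^ (- a0 / 2) * expR (- c0 * k.+1%:R `^ beta)) ^+ 2 <=
    rho k ^+ 2.
    rewrite -[leRHS]real_normK ?num_real// lerXn2r ?nnegrE//.
    by rewrite mulr_ge0 ?expR_ge0// mulr_ge0 ?powR_ge0// ltW.
  rewrite mulrAC ler_pdivlMr ?exprn_gt0//.
  apply: (@le_trans _ _ (M * ((C1 * W k `^ (- a0 / 2) * expR (- c0 *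
    k.+1%:R `^ beta)) ^+ 2 * W k `^ q))); last first.
    by rewrite ler_wpM2l ?(ltW M0)// ler_wpM2r ?powR_ge0.
  rewrite !exprMn.
  have -> : W k `^ (- a0 / 2) ^+ 2 = W k `^ (- a0).
    by rewrite -powR_mulrn ?powR_ge0// -powRrM; congr powR; field.
  have -> : expR (- c0 * k.+1%:R `^ beta) ^+ 2 =
    expR (- (2 * c0 * k.+1%:R `^ beta)).
    by rewrite -expRM_natl; congr expR; ring.
  have -> : M * (C1 ^+ 2 * W k `^ (- a0) * expR (- (2 * c0 *
    k.+1%:R `^ beta)) * W k `^ q) =
    (M * (W k `^ (- a0) * W k `^ q) * expR (- (2 * c0 * k.+1%:R `^ beta))) *
      C1 ^+ 2 by ring.
  rewrite ler_wpM2r ?sqr_ge0//.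
  rewrite -powRD; last by rewrite (gt_eqF wk) implybT.
  have -> : - a0 + q = - (a0 - q) by ring.
  rewrite powRN /c1 mulrDl mul1r opprD expRD.
  apply: ler_pM; rewrite ?expR_ge0//.
    rewrite expRN ler_pdivlMr ?powR_gt0// mulrC ler_pdivrMr ?expR_gt0//.
    by have := MP _ (weight_ge1 k); rewrite mul1r.
  rewrite ler_expR lerN2 ler_wpM2l ?mulr_ge0 ?(ltW c00)//.
  have -> : k.+1%:R `^ beta = (k.+1%:R ^+ 2) `^ (beta / 2) :> R.
    by rewrite -powR_mulrn// -powRrM; congr powR; field.
  by apply: ge0_ler_powR; rewrite ?(ltW b20) ?nnegrE ?sqr_ge0 ?(ltW wk)
    ?sqr_le_weight.
exists M'^-1, c1; split.
- by rewrite invr_gt0.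
- by rewrite /c1 ltr_wpDr// mulr_ge0// ltW.
- by move=> k; rewrite ler_pdivrMl.
Qed.

End rates.
Section error_rate.
Context {R : realType}.
Notation W := (@weight R).

Lemma near_ln_ge (A : R) : \forall n \near \oo, A <= ln (n%:R : R).
Proof.
near=> n.
have h : expR A <= n%:R by near: n; exact: nbhs_infty_ger.
have n0 : 0 < n%:R :> R by apply: lt_le_trans h; exact: expR_gt0.
by rewrite -ler_expR lnK.
Unshelve. all: by end_near.
Qed.

Variables (beta kappa c c1 : R) (s h : nat -> R).
Hypotheses (beta_gt0 : 0 < beta) (kappa_gt0 : 0 < kappa) (c_gt0 : 0 < c)
  (c1_gt0 : 0 < c1).
Hypothesis s_lower : forall k, c * expR (- (c1 * W k `^ (beta / 2))) <= s k.
Hypothesis h_ge0 : forall k, 0 <= h k.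
Hypothesis h_sum : (\sum_(0 <= k <oo) (h k * W k `^ (kappa * beta))%:E < +oo)%E.

Let u (n k : nat) := ln (n%:R : R) `^ (2 * kappa) * (h k / (1 + n%:R * s k)).

Let s_gt0 k : 0 < s k.
Proof. by apply: lt_le_trans (s_lower k); rewrite mulr_gt0 ?expR_gt0. Qed.

Let den_gt0 (n k : nat) : 0 < 1 + n%:R * s k.
Proof. by rewrite ltr_wpDr// mulr_ge0// ltW. Qed.

Let u_ge0 n k : 0 <= u n k.
Proof. by rewrite mulr_ge0 ?powR_ge0// divr_ge0// ltW. Qed.

(** The first bound, at fixed k, tends to 0.  For the second, uniform in n: if
    c1 W_k^(beta/2) <= log n / 2 then n s_k >= c sqrt n, which beats the power
    of log n; otherwise that power is at most a constant times
    W_k^(kappa beta). *)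
Lemma weighted_error_le : exists M1, [/\ 0 < M1,
  forall n k, 1 <= ln (n%:R : R) -> u n k <= (M1 / s k * h k) *
    expR (- (ln (n%:R : R) / 2)) &
  forall n k, 1 <= ln (n%:R : R) ->
    u n k <= (M1 / c + (2 * c1) `^ (2 * kappa)) * (h k * W k `^ (kappa *
      beta))].
Proof.
have [M1 M10 M1P] := @powR_le_expR R (2 * kappa) 1 (1 / 2) (@ltr01 R)
  ltac:(lra).
have TP n : 1 <= ln (n%:R : R) :> R -> ln (n%:R : R) `^ (2 * kappa) <=
  M1 * expR (ln (n%:R : R) / 2) :> R.
  move=> T1; apply: le_trans (M1P _ T1) _.
  have T0 : 0 <= ln (n%:R : R) by apply: le_trans T1.
  by rewrite powRr1// mulrAC mul1r.
have nE n : 1 <= ln (n%:R : R) :> R -> n%:R = expR (ln (n%:R : R) / 2) ^+ 2 :>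
  R.
  move=> T1; rewrite -expRM_natl mulrC divfK// lnK// posrE ltr0n lt0n.
  by apply/eqP => n0; move: T1; rewrite n0 ln0// ler10.
exists M1; split => // n k T1.
  have E0 : 0 < expR (ln (n%:R : R) / 2) :> R by exact: expR_gt0.
  rewrite /u expRN; have := TP n T1; have := nE n T1.
  set E := expR _ in E0 *; move=> nE2 TE.
  apply: (@le_trans _ _ (M1 * E * (h k / (n%:R * s k)))).
    apply: ler_pM; rewrite ?powR_ge0//; first by rewrite divr_ge0// ltW.
    rewrite ler_wpM2l// lef_pV2 ?posrE//; first by rewrite lerDr.
    by rewrite nE2 mulr_gt0// exprn_gt0.
  rewrite nE2 le_eqVlt; apply/orP; left; apply/eqP; field.
  by rewrite !gt_eqF.
have wk := weight_gt0 (R := R) k.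
have Wk1 : 1 <= W k `^ (kappa * beta).
  by rewrite -(powRr0 (W k)); apply: ler_powR;
    [exact: weight_ge1|rewrite mulr_ge0// ltW].
have [h1|h2] := leP (c1 * W k `^ (beta / 2)) (ln (n%:R : R) / 2).
  have E0 : 0 < expR (ln (n%:R : R) / 2) :> R by exact: expR_gt0.
  have Es : c <= expR (ln (n%:R : R) / 2) * s k.
    apply: le_trans (ler_wpM2l (ltW E0) (s_lower k)).
    rewrite mulrCA; apply: ler_peMr; first exact: ltW.
    by rewrite -expRD; apply: le_trans (expR_ge1Dx _); lra.
  have ns : c * expR (ln (n%:R : R) / 2) <= n%:R * s k.
    by rewrite [in leRHS](nE n T1) expr2 -mulrA mulrC ler_wpM2l ?(ltW E0).
  apply: (@le_trans _ _ (M1 / c * (h k * 1))); last first.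
    apply: ler_pM.
    - by rewrite divr_ge0// ltW.
    - by rewrite mulr1.
    - by rewrite lerDl powR_ge0.
    - by rewrite ler_wpM2l.
  rewrite mulr1 /u.
  apply: (@le_trans _ _ (M1 * expR (ln (n%:R : R) / 2) * (h k / (c *
    expR (ln (n%:R : R) / 2))))).
    apply: ler_pM; rewrite ?powR_ge0 ?TP//; first by rewrite divr_ge0// ltW.
    rewrite ler_wpM2l// lef_pV2 ?posrE ?mulr_gt0//.
    by apply: le_trans ns _; rewrite lerDr.
  by rewrite le_eqVlt; apply/orP; left; apply/eqP; field; rewrite !gt_eqF.
apply: (@le_trans _ _ ((2 * c1) `^ (2 * kappa) * (h k * W k `^ (kappa *
  beta)))); last first.
  rewrite ler_wpM2r ?mulr_ge0 ?powR_ge0// lerDr divr_ge0// ltW//.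
have T0 : 0 <= ln (n%:R : R) by apply: le_trans T1.
have TW : ln (n%:R : R) `^ (2 * kappa) <= (2 * c1) `^ (2 * kappa) *
  W k `^ (kappa * beta).
  have -> : (2 * c1) `^ (2 * kappa) * W k `^ (kappa * beta) =
      (2 * c1 * W k `^ (beta / 2)) `^ (2 * kappa).
    rewrite [RHS]powRM ?powR_ge0 ?mulr_ge0 ?(ltW c1_gt0)//; congr (_ * _).
    by rewrite -powRrM; congr powR; field.
  apply: ge0_ler_powR; rewrite ?nnegrE//.
  - by rewrite mulr_ge0// ltW.
  - by rewrite mulr_ge0 ?powR_ge0// mulr_ge0// ltW.
  - lra.
apply: (@le_trans _ _ (ln (n%:R : R) `^ (2 * kappa) * h k)).
  rewrite /u ler_wpM2l ?powR_ge0// ler_pdivrMr//; apply: ler_peMr => //.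
  by rewrite lerDl mulr_ge0// ltW.
apply: le_trans (ler_wpM2r (h_ge0 k) TW) _.
by rewrite le_eqVlt; apply/orP; left; apply/eqP; ring.
Qed.

(** Tannery's theorem, as dominated convergence for the counting measure. *)
Lemma error_series_cvg0 :
  (\sum_(0 <= k <oo) (u n k)%:E @[n --> \oo] --> 0)%E.
Proof.
have [M1 [M10 P1 P2]] := weighted_error_le.
have [N0 _ NP] := near_ln_ge 1.
rewrite -(cvg_shiftn N0).
pose M := M1 / c + (2 * c1) `^ (2 * kappa).
have M0 : 0 <= M by rewrite addr_ge0 ?powR_ge0// divr_ge0// ltW.
have lnn n : 1 <= ln ((n + N0)%:R : R) by apply: NP => /=; exact: leq_addl.
pose f n k := (u (n + N0) k)%:E.
pose g k := (M * (h k * W k `^ (kappa * beta)))%:E.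
have f0 n k : (0 <= f n k)%E by rewrite lee_fin.
have hw0 k : 0 <= h k * W k `^ (kappa * beta) by rewrite mulr_ge0// powR_ge0.
have g0 k : (0 <= g k)%E by rewrite lee_fin mulr_ge0.
rewrite (_ : (fun n => _) = (fun n => \int[counting]_k f n k)%E); last first.
  by apply/funext => n; rewrite ge0_integral_count.
rewrite -(integral0 (@counting nat R) setT).
have [||||| _ _ H] := @dominated_convergence _ nat R counting setT measurableT
  f (cst 0%E) g.
- by [].
- by [].
- apply: aeW => k _.
  apply: cvg_EFin; first exact: nearW.
  have cv : M1 / s k * h k * expR (- (ln ((n +
    N0)%:R : R) / 2)) @[n --> \oo] --> (0 : R).
    rewrite -[X in _ --> X](mulr0 (M1 / s k * h k)); apply: cvgMr.
    apply: (cvg_comp (fun n => ln ((n + N0)%:R : R) / 2) (fun x => expR (-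
      x))); last exact: cvgr_expR.
    apply/cvgryPge => A0; have [m _ mP] := near_ln_ge (2 * A0).
    exists m => // j /= mj.
    have := mP (j + N0)%N (leq_trans mj (leq_addr _ _)); lra.
  apply: (squeeze_cvgr _ (cvg_cst 0) cv).
  by apply: nearW => n; rewrite u_ge0/=; exact: P1.
- apply/integrableP; split => //.
  under eq_integral do rewrite gee0_abs//.
  rewrite ge0_integral_count// /g; under eq_eseriesr do rewrite EFinM.
  rewrite nneseriesZl; last by move=> k _; rewrite lee_fin.
  by rewrite lte_mul_pinfty ?lee_fin.
- by apply: aeW => k n _; rewrite gee0_abs// lee_fin; exact: P2.
exact: H.
Qed.

End error_rate.
(** * Posterior contraction *)

Theorem proposition3p6 (R : realType) (H1 H2 : completeNormedModType R)
    (dot1 : {dot H1 for idfun}) (dot2 : {dot H2 for idfun})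
    (H1_hilbert : separable_hilbert dot1) (H2_hilbert : separable_hilbert dot2)
    (A : {linear H1 -> H2}) (Astar : H2 -> H1)
    (A_cont : continuous A) (A_inj : injective A)
    (A_adj : is_adjoint dot1 dot2 A Astar)
    (e : nat -> H1) (g : nat -> H2) (rho : nat -> R)
    (e_basis : orthonormal_basis dot1 e)
    (e_eigen : forall k, Astar (A (e k)) = rho k ^+ 2 *: e k)
    (g_conj : forall k, A (e k) = rho k *: g k)
    (beta : R) (rho_severe : severely_ill_posed rho beta)
    (gamma : R) (gamma_gt0 : 0 < gamma)
    (f0 : H1) (f0_sobolev : sobolev dot1 e gamma f0)
    (delta : R) (delta_gt : beta / 2 < delta)
    (Lambda : {linear H1 -> H1})
    (Lambda_eigen : forall k,
      Lambda (e k) = weight k `^ (- delta - 1 / 2) *: e k)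
    (Pi : probability (borel H1) R)
    (Pi_gaussian : gaussian_measure dot1 Lambda Pi) :
  exists C0 : R, 0 < C0 /\
    forall C : R, C0 <= C ->
    forall (d : nat -> measure_display) (T : forall n, measurableType (d n))
      (P : forall n, probability (T n) R) (Z : forall n, H2 -> T n -> R),
      (forall n, white_noise dot2 (P n) (Z n)) ->
      cvg0_in_probability P (fun n w =>
        posterior dot1 A e rho Pi n
          (fun k => observation dot2 A f0 n (Z n) (g k) w)
          [set f | `|f - f0| >
             C * ln n%:R `^ (- (Num.min (delta - beta / 2) gamma / beta))]).
Proof.
have b0 := beta_gt0 rho_severe.
set kappa := Num.min (delta - beta / 2) gamma / beta.
have kb : kappa * beta = Num.min (delta - beta / 2) gamma by rewrite /kappa
  divfK// gt_eqF.
have k0 : 0 < kappa by rewrite divr_gt0// lt_min gamma_gt0 subr_gt0 delta_gt.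
pose v k : R := weight k `^ (- delta - 1 / 2).
pose a k := dot1 f0 (e k).
have v0 k : 0 < v k by rewrite powR_gt0// weight_gt0.
have v1 k : v k <= 1.
  rewrite -[leRHS](powRr0 (weight k)); apply: ler_powR; first exact: weight_ge1.
  lra.
have rho0 := singular_value_neq0 A_inj e_basis g_conj.
have [c [c1 [c0 c10 low]]] := severe_lower rho_severe (- delta - 1 / 2) rho0.
have rho_sum := severe_upper rho_severe.
pose h k := 3 * v k + 2 * a k ^+ 2.
have h0 k : 0 <= h k.
  by apply: addr_ge0; rewrite mulr_ge0 ?sqr_ge0// ltW.
have h_sum : (\sum_(0 <= k <oo) (h k * weight k `^ (kappa * beta))%:E < +oo)%E.
  rewrite kb.
  apply: (@le_lt_trans _ _ (\sum_(0 <= k <oo) (3%:E * (weight k `^ (- (1 / 2 +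
    beta / 2)))%:E +
      2%:E * (a k ^+ 2 * weight k `^ gamma)%:E))%E).
    apply: lee_nneseries => [k _ _|k _].
      by rewrite lee_fin mulr_ge0// powR_ge0.
    rewrite -!EFinM -EFinD lee_fin /h mulrDl; apply: lerD;
      rewrite -[leLHS]mulrA.
      rewrite ler_wpM2l// /v -powRD; last by rewrite (gt_eqF (weight_gt0 k))
        implybT.
      apply: ler_powR; first exact: weight_ge1.
      have : Num.min (delta - beta / 2) gamma <=
        delta - beta / 2 by rewrite ge_min lexx.
      lra.
    apply: ler_wpM2l => //; apply: ler_wpM2l; first exact: sqr_ge0.
    apply: ler_powR; first exact: weight_ge1.
    by rewrite ge_min lexx orbT.
  rewrite nneseriesD; last 2 first.
  - by move=> k _ _; rewrite -EFinM lee_fin mulr_ge0// powR_ge0.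
  - by move=> k _ _; rewrite -EFinM lee_fin mulr_ge0// mulr_ge0 ?sqr_ge0
    ?powR_ge0.
  rewrite !nneseriesZl; last 2 first.
  - by move=> k _; rewrite lee_fin mulr_ge0 ?sqr_ge0 ?powR_ge0.
  - by move=> k _; rewrite lee_fin powR_ge0.
  rewrite lte_add_pinfty//; apply: lte_mul_pinfty => //; rewrite ?lee_fin//.
  by apply: summable_weight; lra.
have cv := error_series_cvg0 b0 k0 c0 c10 low h0 h_sum.
exists 1; split => // C C1 d T P Z ZW eps eps0.
have C0 : 0 < C by lra.
pose K : R := (1 - expR (- 1))^-1.
pose B : R := K / (C ^+ 2 * eps).
have Bcv : (B%:E * \sum_(0 <= k <oo) (ln (n%:R : R) `^ (2 * kappa) *
  (h k / (1 + n%:R * (rho k ^+ 2 * v k))))%:E @[n --> \oo] --> 0)%E.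
  rewrite -[X in _ --> X](mule0 B%:E); apply: cvgeZl => //; exact: cv.
apply: (squeeze_cvge _ (cvg_cst 0%E) Bcv).
have [N _ NP] := near_ln_ge (1 : R).
exists N.+1 => // n /= Nn.
have n0 : (0 < n)%N by exact: leq_trans Nn.
have T1 : 1 <= ln (n%:R : R) by apply: NP; exact: ltnW.
rewrite measure_ge0/=.
set t := C * _.
have lt0 : 0 < ln (n%:R : R) by lra.
have t0 : 0 < t by rewrite mulr_gt0// powR_gt0.
apply: (le_trans (posterior_tail_prob H1_hilbert H2_hilbert A_cont A_inj A_adj
  e_basis
  e_eigen g_conj v0 v1 Lambda_eigen Pi_gaussian rho_sum f0 n0 (ZW n) t0 eps0)).
have r0 k : 0 <= h k / (1 + n%:R * (rho k ^+ 2 * v k)).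
  by rewrite divr_ge0// addr_ge0// mulr_ge0// mulr_ge0 ?sqr_ge0// ltW.
have -> : (\sum_(0 <= k <oo) (ln (n%:R : R) `^ (2 * kappa) * (h k / (1 + n%:R *
  (rho k ^+ 2 * v k))))%:E =
    (ln (n%:R : R) `^ (2 * kappa))%:E * \sum_(0 <=
      k <oo) (h k / (1 + n%:R * (rho k ^+ 2 * v k)))%:E)%E.
  by rewrite -nneseriesZl// => k _; rewrite lee_fin.
rewrite muleA -EFinM.
rewrite (_ : B * _ = (1 - expR (- 1))^-1 / (t ^+ 2 * eps)).
  rewrite le_eqVlt; apply/orP; left; apply/eqP; congr (_ * _)%E.
  by apply: eq_eseriesr => k _; rewrite mulrA.
have -> : t ^+ 2 = C ^+ 2 / ln n%:R `^ (2 * kappa).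
  rewrite /t exprMn; congr (_ * _).
  rewrite -powR_mulrn ?powR_ge0// -powRrM -powRN; congr powR; ring.
rewrite /B -/K; field.
by rewrite !gt_eqF// powR_gt0.
Qed.
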